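(* Consider $\mathcal S_n$ with the uniform probability measure $\mathsf P_n$. (i) For every $n\ge1$, $\Delta_n$ has the same distribution as $\sum_{k=1}^n I_k$, where $I_1,\dots,I_n$ are independent with $\mathsf P(I_k=1)=1-\frac{1}{2k}$ and $\mathsf P(I_k=0)=\frac1{2k}$. In particular, $$\mathsf E_n\Delta_n=n-\frac{H_n}{2},\qquad \operatorname{var}(\Delta_n)=\frac{H_n}{2}-\frac{H_n^{(2)}}{4},$$ and, as $n\to\infty$, $$\frac{\Delta_n-n+\frac12\ln n}{\sqrt{\frac12\ln n}}\xrightarrow{d}N(0,1).$$ (ii) For every $n\ge1$, $\Gamma_n$ has the same distribution as $\Delta_n$; in particular all statements of (i) hold with $\Delta_n$ replaced by $\Gamma_n$.
   Context: A staircase tableau of size $n$ is a Young diagram of shape $(n,n-1,\dots,2,1)$ (English convention: rows left-justified, the $i$-th row from the top has $n-i+1$ boxes) whose boxes are filled according to the rules: each box is either empty or contains one of the letters $\alpha,\beta,\gamma,\delta$; no box on the diagonal (the rightmost box of each row) is empty; all boxes in the same row and to the left of a $\beta$ or a $\delta$ are empty; all boxes in the same column and above an $\alpha$ or a $\gamma$ are empty. $\mathcal S_n$ is the set of staircase tableaux of size $n$; $\mathsf P_n$ is the uniform probability measure on it, $\mathsf E_n$ the corresponding expectation, and variances are under $\mathsf P_n$. For $S\in\mathcal S_n$, $\Delta_n(S)$ is the total number of boxes of $S$ containing $\beta$ or $\delta$, and $\Gamma_n(S)$ is the total number of boxes containing $\alpha$ or $\gamma$. $H_n=\sum_{k=1}^n\frac1k$,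 $H_n^{(2)}=\sum_{k=1}^n\frac1{k^2}$; $N(0,1)$ is the standard normal law and $\xrightarrow{d}$ denotes convergence in distribution. *)

(* Defs.v *)
From HB Require Import structures.
From mathcomp Require Import all_boot all_order all_algebra.
From mathcomp Require Import all_classical all_reals all_analysis.

Set Implicit Arguments.
Unset Strict Implicit.
Unset Printing Implicit Defensive.

Import Order.TTheory GRing.Theory Num.Theory.
Import numFieldNormedType.Exports.

Local Open Scope classical_set_scope.
Local Open Scope ring_scope.

Inductive letter := Alpha | Beta | Gamma | Delta.

Definition letter_code (l : letter) : bool * bool :=
  match l with
  | Alpha => (false, false) | Beta => (false, true)
  | Gamma => (true, false) | Delta => (true, true)
  end.

Definition letter_decode (c : bool * bool) : letter :=
  match c with
  | (false, false) => Alpha | (false, true) => Beta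
  | (true, false) => Gamma | (true, true) => Delta
  end.

Lemma letter_codeK : cancel letter_code letter_decode.
Proof. by case. Qed.

HB.instance Definition _ := Equality.copy letter (can_type letter_codeK).
HB.instance Definition _ := Choice.copy letter (can_type letter_codeK).
HB.instance Definition _ := Countable.copy letter (can_type letter_codeK).
HB.instance Definition _ := Finite.copy letter (can_type letter_codeK).

(* Rows (from the top) and columns (from the left) are numbered from 0: row i
   of the shape (n, n-1, ..., 1) consists of the boxes (i, j) with i + j < n,
   and its rightmost box is the one with i + j + 1 = n. *)
Definition box (n : nat) := {p : 'I_n * 'I_n | (p.1 + p.2 < n)%N}.

Definition row_of (n : nat) (b : box n) : nat := (val b).1.
Definition col_of (n : nat) (b : box n) : nat := (val b).2.

Definition on_diagonal (n : nat) (b : box n) : bool :=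
  (row_of b + col_of b).+1 == n.

Definition filling (n : nat) := {ffun box n -> option letter}.

Definition has_ag (n : nat) (S : filling n) (b : box n) : bool :=
  (S b == Some Alpha) || (S b == Some Gamma).
Definition has_bd (n : nat) (S : filling n) (b : box n) : bool :=
  (S b == Some Beta) || (S b == Some Delta).

Definition is_staircase (n : nat) (S : filling n) : bool :=
  [&& [forall b, on_diagonal b ==> (S b != None)],
      [forall b, forall c, has_bd S b && (row_of c == row_of b)
         && (col_of c < col_of b)%N ==> (S c == None)]
    & [forall b, forall c, has_ag S b && (col_of c == col_of b)
         && (row_of c < row_of b)%N ==> (S c == None)]].

Definition staircase (n : nat) := {S : filling n | is_staircase S}.

HB.instance Definition _ (n : nat) := Finite.on (staircase n).

Fact all_alpha_staircase (n : nat) :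
  is_staircase [ffun b : box n => if on_diagonal b then Some Alpha else None].
Proof.
apply/and3P; split.
- by apply/forallP => b; rewrite ffunE; case: ifP.
- apply/forallP => b; apply/forallP => c.
  by rewrite /has_bd ffunE; case: ifP.
- apply/forallP => b; apply/forallP => c; apply/implyP.
  rewrite /has_ag !ffunE; case: ifP => //= /eqP bd /andP[/eqP cb rcb].
  by rewrite /on_diagonal cb ifN// -[X in _ != X]bd eqSS eqn_add2r ltn_eqF.
Qed.

HB.instance Definition _ (n : nat) := isPointed.Build (staircase n)
  (exist (@is_staircase n) _ (all_alpha_staircase n)).
HB.instance Definition _ (n : nat) :=
  @isMeasurable.Build default_measure_display (staircase n)
    discrete_measurable discrete_measurable0
    discrete_measurableC discrete_measurableU.

Section uniform_measure.
Variables (R : realType) (n : nat).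
Local Open Scope ereal_scope.

Definition unif (A : set (staircase n)) : \bar R :=
  (#|[set S : staircase n | S \in A]%SET|%:R / #|{: staircase n}|%:R)%:E.

Let card_gt0 : (0 < #|{: staircase n}|)%N.
Proof. by apply/card_gt0P; exists point. Qed.

Let unifE A : unif A =
  mscale (NngNum (ltW (@divr_gt0 R 1 #|{: staircase n}|%:R
            ltr01 (etrans (ltr0n _ _) card_gt0))))
    (msum (fun k => dirac (nth point (enum {: staircase n}) k))
       #|{: staircase n}|) A.
Proof.
rewrite /mscale /msum /= /unif mulrC div1r EFinM; congr (_ * _).
rewrite -sum1_card natr_sum big_mkcond /=.
transitivity (\sum_(S <- enum {: staircase n}) (dirac S A : \bar R)).
  rewrite big_enum /= -sumEFin; apply: eq_bigr => S _.
  by rewrite diracE inE; case: (S \in A).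
by rewrite (big_nth point) big_mkord -cardE.
Qed.

Let unif0 : unif set0 = 0. Proof. by rewrite unifE measure0. Qed.
Let unif_ge0 A : 0 <= unif A. Proof. by rewrite unifE measure_ge0. Qed.
Let unif_semi_sigma_additive : semi_sigma_additive unif.
Proof.
by rewrite (funext unifE : unif = _); exact: measure_semi_sigma_additive.
Qed.

HB.instance Definition _ := isMeasure.Build _ _ _ unif
  unif0 unif_ge0 unif_semi_sigma_additive.

Let unif_setT : unif [set: staircase n] = 1.
Proof.
have -> : unif [set: staircase n] =
    (#|{: staircase n}|%:R / #|{: staircase n}|%:R)%:E.
  congr (_%:R / _)%:E; apply: eq_card => S; rewrite !inE; exact: mem_setT.
by rewrite divff// pnatr_eq0 -lt0n.
Qed.

HB.instance Definition _ := Measure_isProbability.Build _ _ _ unif unif_setT.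
End uniform_measure.
Arguments unif : clear implicits.

(* The sigma-algebra on [staircase n] is discrete: every function is a random
   variable. *)
Section tableau_random_variables.
Variables (R : realType) (n : nat).

Definition tableau_fun (f : staircase n -> R) : staircase n -> R := f.

Let measurable_tableau_fun f : measurable_fun setT (tableau_fun f).
Proof. by []. Qed.

HB.instance Definition _ f := @isMeasurableFun.Build _ _ _ _
  (tableau_fun f) (measurable_tableau_fun f).

Definition tableau_rv (f : staircase n -> R) : {RV (unif R n) >-> R} :=
  tableau_fun f.

Definition Delta_n : {RV (unif R n) >-> R} :=
  tableau_rv (fun S => #|[set b | has_bd (val S) b]%SET|%:R).

Definition Gamma_n : {RV (unif R n) >-> R} :=
  tableau_rv (fun S => #|[set b | has_ag (val S) b]%SET|%:R).

Definition rescaled (X : {RV (unif R n) >-> R}) : {RV (unif R n) >-> R} :=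
  tableau_rv (fun S => (X S - n%:R + ln n%:R / 2) / Num.sqrt (ln n%:R / 2)).
End tableau_random_variables.

Definition same_law (R : realType)
    (d : measure_display) (T : measurableType d) (P : probability T R)
    (X : {RV P >-> R})
    (d' : measure_display) (T' : measurableType d') (P' : probability T' R)
    (Y : {RV P' >-> R}) : Prop :=
  forall A : set R, measurable A -> distribution P X A = distribution P' Y A.

Definition mutually_independent (R : realType) (d : measure_display)
    (T : measurableType d) (P : probability T R) (I : finType)
    (X : I -> {RV P >-> R}) : Prop :=
  forall (J : {set I}) (A : I -> set R),
    (forall j, j \in J -> measurable (A j)) ->
    P (\bigcap_(j in [set` J]) (X j @^-1` A j)) =
    (\prod_(j in J) P (X j @^-1` A j))%E.

(* The index k : 'I_n stands for k + 1 in {1, ..., n}. *)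
Definition staircase_indicators (R : realType) (n : nat) (d : measure_display)
    (T : measurableType d) (P : probability T R)
    (I : 'I_n -> {RV P >-> R}) : Prop :=
  [/\ mutually_independent I,
      forall k, P (I k @^-1` [set 1]) = (1 - (2 * k.+1%:R)^-1)%:E
    & forall k, P (I k @^-1` [set 0]) = ((2 * k.+1%:R)^-1)%:E].

Section random_variable_sum.
Variables (R : realType) (n : nat) (d : measure_display).
Variables (T : measurableType d) (P : probability T R).

Definition sum_fun (I : 'I_n -> {RV P >-> R}) : T -> R :=
  fun w => \sum_(k < n) I k w.

Let measurable_sum_fun I : measurable_fun setT (sum_fun I).
Proof. by apply: measurable_sum => k; exact: measurable_funPT. Qed.

HB.instance Definition _ I := @isMeasurableFun.Build _ _ _ _
  (sum_fun I) (measurable_sum_fun I).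

Definition rv_sum (I : 'I_n -> {RV P >-> R}) : {RV P >-> R} := sum_fun I.
End random_variable_sum.

Definition cvg_in_distribution (R : realType)
    (d : nat -> measure_display) (T : forall n, measurableType (d n))
    (P : forall n, probability (T n) R) (X : forall n, {RV (P n) >-> R})
    (mu : probability (measurableTypeR R) R) : Prop :=
  forall x : R, {for x, continuous (fun t : R => mu `]-oo, t]%classic)} ->
    cdf (X n) x @[n --> \oo] --> mu `]-oo, x]%classic.

Definition H_ (R : realType) (n : nat) : R :=
  \sum_(1 <= k < n.+1) (k%:R)^-1.
Definition H2_ (R : realType) (n : nat) : R :=
  \sum_(1 <= k < n.+1) (k%:R ^+ 2)^-1.

(* Main.v *)
(** Removing the leftmost column of a tableau of size [n + 1] leaves a tableau
    of size [n]. The removed column may only be non-empty in its bottom box and in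
    the rows without beta or delta; summing over all its fillings shows that
    [F n a b], the sum of [a ^ (rows without beta, delta) * b ^ (number of betas
    and deltas)], satisfies [F (n + 1) a b = 2 (a + b) F n (a + 2 b) b]. Hence
    [F n 1 x] is the product of the factors [2 + 2 (2 k + 1) x], [k < n], that is,
    up to normalisation, the generating function of a sum of independent
    Bernoulli variables. Transposition exchanges the two statistics.

    The normal limit is obtained by Lindeberg's method with the explicit heat
    flow [heat s y = Phi (y / sqrt s)]: a centred Bernoulli summand of variance
    [v] changes the expectation of [heat s] like the shift from [s] to [s + v],
    up to third order terms, and [heat (delta ^ 2)] is a smoothed indicator
    function of a half-line as [delta] tends to [0]. *)
From HB Require Import structures.
Require Import Defs.
From mathcomp Require Import all_boot all_order all_algebra.
From mathcomp Require Import all_classical all_reals all_analysis.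
From mathcomp Require Import ring lra zify.

Set Implicit Arguments.
Unset Strict Implicit.
Unset Printing Implicit Defensive.

Import Order.TTheory GRing.Theory Num.Theory.
Import numFieldNormedType.Exports.

Local Open Scope classical_set_scope.
Local Open Scope ring_scope.

(** * Generating function of staircase tableaux *)

Definition is_bd (x : option letter) : bool :=
  (x == Some Beta) || (x == Some Delta).
Definition is_ag (x : option letter) : bool :=
  (x == Some Alpha) || (x == Some Gamma).

(** Reading [None] outside the shape allows row and column rules without bounds, and lets fillings
    of sizes [n] and [n.+1] be compared without transporting dependent boxes. *)
Definition cell n (S : filling n) (i j : nat) : option letter :=
  oapp S None [pick b | (row_of b == i) && (col_of b == j)].

Lemma box_eqP n (b c : box n) :
  row_of b = row_of c -> col_of b = col_of c -> b = c.
Proof.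
case: b c => [[i j] ij] [[k l] kl] /= /val_inj /= ik /val_inj /= jl.
by apply: val_inj; rewrite /= ik jl.
Qed.

Lemma box_exists n i j : (i + j < n)%N ->
  exists2 b : box n, row_of b = i & col_of b = j.
Proof.
move=> ij; have hi : (i < n)%N by lia.
have hj : (j < n)%N by lia.
by exists (exist (fun p : 'I_n * 'I_n => (p.1 + p.2 < n)%N)
  (Ordinal hi, Ordinal hj) ij).
Qed.

Lemma box_bound n (b : box n) : (row_of b + col_of b < n)%N.
Proof. exact: valP b. Qed.

Lemma cell_box n (S : filling n) b : cell S (row_of b) (col_of b) = S b.
Proof.
rewrite /cell; case: pickP => [c /andP[/eqP hr /eqP hc] /=|/(_ b)].
  by congr (S _); apply: box_eqP.
by rewrite !eqxx.
Qed.

Lemma cell_out n (S : filling n) i j : (n <= i + j)%N -> cell S i j = None.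
Proof.
rewrite /cell; case: pickP => [c /andP[/eqP <- /eqP <-] /=|//].
by rewrite leqNgt box_bound.
Qed.

Lemma cell_inj n (S S' : filling n) :
  (forall i j, (i + j < n)%N -> cell S i j = cell S' i j) -> S = S'.
Proof.
by move=> h; apply/ffunP => b; rewrite -!cell_box h// box_bound.
Qed.

Lemma cell_finfun n (g : nat -> nat -> option letter) i j : (i + j < n)%N ->
  cell [ffun b : box n => g (row_of b) (col_of b)] i j = g i j.
Proof.
by move=> ij; have [b <- <-] := box_exists ij; rewrite cell_box ffunE.
Qed.

Record staircase_spec n (S : filling n) : Prop := StaircaseSpec {
  staircase_diag : forall i j, (i + j).+1 = n -> cell S i j <> None;
  staircase_row : forall i j j', is_bd (cell S i j) -> (j' < j)%N ->
    cell S i j' = None;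
  staircase_col : forall i i' j, is_ag (cell S i j) -> (i' < i)%N ->
    cell S i' j = None }.

Lemma staircaseP n (S : filling n) : reflect (staircase_spec S) (is_staircase S).
Proof.
apply: (iffP and3P) => [[h1 h2 h3]|[h1 h2 h3]]; split.
- move=> i j ij; have [b hi hj] : exists2 b : box n, row_of b = i & col_of b = j.
    by apply: box_exists; rewrite -ij.
  have /implyP := forallP h1 b; rewrite /on_diagonal hi hj ij eqxx => /(_ isT).
  by rewrite -cell_box hi hj => /eqP.
- move=> i j j' bd jj'.
  have [ij|/cell_out h] := ltnP (i + j) n; last by rewrite h in bd.
  have [b hi hj] := box_exists ij.
  have [c ci cj] : exists2 b : box n, row_of b = i & col_of b = j'.
    by apply: box_exists; lia.
  have /implyP := forallP (forallP h2 b) c.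
  by rewrite /has_bd -!cell_box hi hj ci cj eqxx jj' -/(is_bd _) bd => /(_ isT)/eqP.
- move=> i i' j ag ii'.
  have [ij|/cell_out h] := ltnP (i + j) n; last by rewrite h in ag.
  have [b hi hj] := box_exists ij.
  have [c ci cj] : exists2 b : box n, row_of b = i' & col_of b = j.
    by apply: box_exists; lia.
  have /implyP := forallP (forallP h3 b) c.
  by rewrite /has_ag -!cell_box hi hj ci cj eqxx ii' -/(is_ag _) ag => /(_ isT)/eqP.
- apply/forallP => b; apply/implyP => /eqP h; rewrite -cell_box.
  by apply/eqP/h1.
- apply/forallP => b; apply/forallP => c; apply/implyP.
  move=> /andP[/andP[bd /eqP rcb] ccb]; rewrite -cell_box rcb; apply/eqP.
  by apply: h2 ccb; rewrite cell_box.
- apply/forallP => b; apply/forallP => c; apply/implyP.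
  move=> /andP[/andP[ag /eqP ccb] rcb]; rewrite -cell_box ccb; apply/eqP.
  by apply: h3 rcb; rewrite cell_box.
Qed.

(** Since [p] rejects [None], the positions of the square outside the shape count for nothing.
    Peeling off a column or transposing then becomes a manipulation of a double sum. *)
Lemma sum_box_cell n (S : filling n) (p : option letter -> bool) :
  p None = false ->
  #|[set b | p (S b)]%SET| = (\sum_(i < n) \sum_(j < n) p (cell S i j))%N.
Proof.
move=> p0; rewrite pair_big /=.
rewrite (bigID (fun x : 'I_n * 'I_n => (x.1 + x.2 < n)%N)) /= [X in (_ + X)%N]big1.
  rewrite addn0 -sum1_card big_mkcond /=.
  rewrite (reindex_omap (fun b : box n => val b) insub) /=; last first.
    by move=> x hx; rewrite insubT.
  rewrite [RHS](eq_bigl predT); last first.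
    by move=> b; rewrite valK eqxx andbT box_bound.
  by apply: eq_bigr => b _; rewrite inE -[X in p X]cell_box; case: (p _).
by move=> x; rewrite -leqNgt => /cell_out ->; rewrite p0.
Qed.

(** * Attaching a column on the left *)

Definition row_free n (S : filling n) (i : nat) : bool :=
  [forall j : 'I_n, ~~ is_bd (cell S i j)].

Definition num_bd n (S : filling n) : nat := #|[set b | is_bd (S b)]%SET|.

(* Rows are read from the bottom, so that a column is filled by bd letters and
   empty boxes up to its only ag letter, above which it is empty. *)
Definition row_mask n (S : filling n) : seq bool :=
  mkseq (fun k => row_free S (n - k.+1)) n.

(** The column is read upwards: its head sits on the diagonal in the new bottom row [n], and the
    entries after the head are in step with [row_mask S]. *)
Definition attach_column n (S : filling n) (t : seq (option letter)) :
    filling n.+1 :=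
  [ffun b => if col_of b is j.+1 then cell S (row_of b) j
             else nth None t (n - row_of b)].

Lemma cell_attach0 n (S : filling n) t i : (i <= n)%N ->
  cell (attach_column S t) i 0 = nth None t (n - i).
Proof.
move=> hi.
by rewrite (@cell_finfun n.+1 (fun i j => if j is j.+1 then cell S i j
   else nth None t (n - i)))// addn0 ltnS.
Qed.

Lemma cell_attachS n (S : filling n) t i j :
  cell (attach_column S t) i j.+1 = cell S i j.
Proof.
have [ij|ij] := ltnP (i + j) n; last by rewrite !cell_out// addnS ltnS.
by rewrite (@cell_finfun n.+1 (fun i j => if j is j.+1 then cell S i j
   else nth None t (n - i)))// addnS ltnS.
Qed.

(** The recursive form matches the induction in [sum_columns]; [column_okP] gives the pointwise
    meaning. *)
Fixpoint column_ok (m : seq bool) (t : seq (option letter)) : bool :=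
  if t is x :: t' then
    if is_ag x then head false m && all (pred1 None) t'
    else (is_bd x ==> head false m) && column_ok (behead m) t'
  else true.

(** The bottom box is on the diagonal, hence not empty, and it is alone in its row, so no mask bit
    restricts it. *)
Definition bottom_ok (x : option letter) (m : seq bool) t : bool :=
  if is_ag x then all (pred1 None) t else is_bd x && column_ok m t.

Definition mask_update (m : seq bool) (t : seq (option letter)) : seq bool :=
  [seq p.1 && ~~ is_bd p.2 | p <- zip m t].

Lemma letter_cases x : [\/ is_ag x, is_bd x | x = None].
Proof.
case: x => [[]|]; [constructor 1|constructor 2|constructor 1|constructor 2
 |constructor 3] => //.
Qed.

Lemma column_okP m t : size m = size t ->
  reflect ((forall k, nth None t k <> None -> nth false m k) /\
           (forall k k', is_ag (nth None t k) -> (k < k')%N ->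
              nth None t k' = None))
          (column_ok m t).
Proof.
elim: t m => [|x t IH] [|c m] //=; first by move=> _; left; split=> k; rewrite nth_nil.
move=> [sz]; case: ifP => agx.
  apply: (iffP andP) => [[cT /allP tN]|[h1 h2]].
    have tN' k : nth None t k = None.
      have [kt|kt] := ltnP k (size t); last by rewrite nth_default.
      by apply/eqP/tN/mem_nth.
    split=> [[|k]|[|k] [|k']] //=; rewrite ?tN'//.
  split; first by apply: (h1 0%N) => /= xN; rewrite xN in agx.
  apply/(all_nthP None) => k kt; apply/eqP; exact: (h2 0%N k.+1).
apply: (iffP andP) => [[/implyP hc /(IH _ sz)[h1 h2]]|[h1 h2]].
  split=> [[|k]|[|k] [|k']] //=; rewrite ?agx//.
  - move=> xN; apply: hc; move: (letter_cases x) => [|//|//].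
    by rewrite agx.
  - exact: h1.
  - exact: h2.
split.
  by apply/implyP => bd; apply: (h1 0%N) => /= xN; rewrite xN in bd.
apply/(IH _ sz); split=> [k|k k'].
- exact: (h1 k.+1).
- move=> hk kk'; exact: (h2 k.+1 k'.+1).
Qed.

Lemma row_freeP n (S : filling n) i :
  reflect (forall j, is_bd (cell S i j) = false) (row_free S i).
Proof.
apply: (iffP forallP) => [h j|h j]; last by rewrite h.
have [jn|nj] := ltnP j n; last by rewrite cell_out// (leq_trans nj)// leq_addl.
exact/negbTE/(h (Ordinal jn)).
Qed.

Lemma nth_row_mask n (S : filling n) k : (k < n)%N ->
  nth false (row_mask S) k = row_free S (n - k.+1).
Proof. by move=> kn; rewrite nth_mkseq. Qed.

(** The rules inside [S] are unchanged by the shift of its columns. The new constraints are the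
    column rule in column 0 and the row rule for its letters, which must have no beta or delta to
    their right; the mask records exactly this. *)
Lemma attach_staircase n (S : filling n) x t : size t = n ->
  is_staircase (attach_column S (x :: t)) =
  is_staircase S && bottom_ok x (row_mask S) t.
Proof.
move=> sz.
have szm : size (row_mask S) = size t by rewrite size_mkseq.
apply/idP/andP => [/staircaseP[h1 h2 h3]|[/staircaseP[h1 h2 h3] hx]].
  have cS i j := esym (cell_attachS S (x :: t) i j).
  have cx : cell (attach_column S (x :: t)) n 0 = x.
    by rewrite cell_attach0// subnn.
  have ct k : (k < n)%N ->
      cell (attach_column S (x :: t)) (n - k.+1) 0 = nth None t k.
    move=> kn; rewrite cell_attach0 ?leq_subr// subKn//.
  split.
    apply/staircaseP; split => [i j ij|i j j'|i i' j]; rewrite !cS.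
    - by apply: h1; rewrite addnS ij.
    - move=> bd jj'; exact: h2 bd _.
    - exact: h3.
  rewrite /bottom_ok; case: ifP => agx.
    apply/(all_nthP None) => k; rewrite sz => kn; rewrite /= -ct//.
    apply/eqP; apply: (h3 n); [by rewrite cx|lia].
  apply/andP; split.
    have : x <> None by rewrite -cx; apply: h1; rewrite addn0.
    by move: (letter_cases x) => [|//|//]; rewrite agx.
  apply/column_okP => //; split=> [k|k k'].
    have [kn|kn] := ltnP k n; last by rewrite nth_default// sz.
    move=> tk; rewrite nth_row_mask//; apply/row_freeP => j.
    apply/negP; rewrite cS => bd; apply: tk; rewrite -ct//.
    exact: h2 bd _.
  have [kn|kn] := ltnP k' n; last by rewrite [nth _ _ k']nth_default// sz.
  move=> ag kk'; rewrite -ct//; apply: (h3 (n - k.+1)%N); last lia.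
  by rewrite ct//; lia.
have xN : x <> None by move=> xN; move: hx; rewrite xN.
have tag k k' : is_ag (nth None (x :: t) k) -> (k < k')%N ->
    nth None (x :: t) k' = None.
  move: hx; rewrite /bottom_ok; case: ifP => agx.
    move=> /allP tN; case: k' => [//|k' _ _ /=].
    have [kt|kt] := ltnP k' (size t); last by rewrite nth_default.
    by apply/eqP/tN/mem_nth.
  move=> /andP[_ /(column_okP szm)[_ hag]].
  by case: k k' => [|k] [|k'] //=; rewrite ?agx//; exact: hag.
have tbd k : (k < n)%N -> nth None t k <> None -> row_free S (n - k.+1).
  move: hx; rewrite /bottom_ok; case: ifP => agx.
    move=> /allP tN kn; case; apply/eqP/tN/mem_nth; by rewrite sz.
  move=> /andP[_ /(column_okP szm)[hfr _]] kn /hfr.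
  by rewrite nth_row_mask.
apply/staircaseP; split => [i [|j] ij|i [|j] [|j']|i i' [|j]] //;
  rewrite ?cell_attachS.
- have -> : i = n by lia.
  by rewrite cell_attach0// subnn.
- by apply: h1; lia.
- move=> bd _.
  have ijn : (i < n)%N.
    by rewrite ltnNge; apply/negP => ni; rewrite cell_out ?(leq_trans ni) ?leq_addr in bd.
  rewrite cell_attach0 ?(ltnW ijn)//.
  have nE : (n - i)%N = (n - i.+1).+1 by lia.
  rewrite nE /=; apply/eqP; apply: contraT => /eqP /tbd.
  have -> : (n - (n - i.+1).+1)%N = i by lia.
  by move=> /(_ ltac:(lia))/row_freeP /(_ j); rewrite bd.
- move=> bd jj'; exact: h2 bd _.
- have [ni|ni] := leqP i n; last by rewrite cell_out// addn0.
  move=> + ii'; rewrite !cell_attach0 ?(leq_trans (ltnW ii'))// => ag.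
  apply: tag ag _; lia.
- exact: h3.
Qed.

Lemma row_mask_attach n (S : filling n) x t : size t = n ->
  row_mask (attach_column S (x :: t)) =
  ~~ is_bd x :: mask_update (row_mask S) t.
Proof.
move=> sz; apply: (@eq_from_nth _ false).
  by rewrite size_mkseq /= size_map size_zip size_mkseq sz minnn.
move=> k; rewrite size_mkseq => kn; rewrite nth_row_mask// subSS.
have fr i : (i <= n)%N -> row_free (attach_column S (x :: t)) i =
    row_free S i && ~~ is_bd (nth None (x :: t) (n - i)).
  move=> hi; apply/row_freeP/andP => [h|[/row_freeP h1 h2] [|j]].
  - split; first by apply/row_freeP => j; rewrite -(cell_attachS S (x :: t)).
    by rewrite -(cell_attach0 S _ hi) h.
  - by rewrite cell_attach0//; exact/negbTE.
  - by rewrite cell_attachS.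
rewrite fr ?leq_subr// subKn//.
case: k kn => [|k] kn /=.
  rewrite subn0; have -> : row_free S n.
    by apply/row_freeP => j; rewrite cell_out// leq_addr.
  by [].
rewrite (nth_map (false, None)) ?size_zip ?size_mkseq ?sz ?minnn//.
by rewrite nth_zip ?size_mkseq ?sz//= nth_row_mask.
Qed.

Lemma num_bd_attach n (S : filling n) x t : size t = n ->
  num_bd (attach_column S (x :: t)) = (num_bd S + is_bd x + count is_bd t)%N.
Proof.
move=> sz; rewrite /num_bd !sum_box_cell//.
under eq_bigr do rewrite big_ord_recl /=.
rewrite big_split /= addnC -addnA; congr (_ + _)%N.
  rewrite big_ord_recr /= [X in (_ + X)%N]big1 ?addn0; last first.
    by move=> j _; rewrite cell_attachS cell_out// leq_addr.
  by apply: eq_bigr => i _; apply: eq_bigr => j _; rewrite cell_attachS.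
(* Reversing the rows turns the sum over column 0 into a sum along [x :: t], which starts at the
   bottom. *)
rewrite (reindex_inj rev_ord_inj) /= big_ord_recl /= subSS subn0.
rewrite cell_attach0// subnn; congr (_ + _)%N.
rewrite -sum1_count (big_nth None) sz big_mkord [RHS]big_mkcond /=.
apply: eq_bigr => i _; rewrite /bump /= add1n subSS.
rewrite cell_attach0 ?leq_subr// subKn// ?ltn_ord//=.
Qed.

Lemma attach_inj n (S S' : filling n) x x' t t' : size t = n -> size t' = n ->
  attach_column S (x :: t) = attach_column S' (x' :: t') ->
  [/\ S = S', x = x' & t = t'].
Proof.
move=> sz sz' e.
have hc k : (k <= n)%N -> nth None (x :: t) k = nth None (x' :: t') k.
  move=> kn; have := cell_attach0 S (x :: t) (leq_subr k n).
  by rewrite e cell_attach0 ?leq_subr// subKn.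
split.
- apply: cell_inj => i j _.
  by rewrite -(cell_attachS S (x :: t)) e cell_attachS.
- exact: (hc 0%N).
- apply: (@eq_from_nth _ None); first by rewrite sz.
  move=> k; rewrite sz => kn; exact: (hc k.+1).
Qed.

Lemma attach_surj n (S : filling n.+1) :
  exists (S' : filling n) (x : option letter) (t : n.-tuple (option letter)),
    S = attach_column S' (x :: t).
Proof.
exists [ffun b => cell S (row_of b) (col_of b).+1], (cell S n 0).
exists (Tuple (introT eqP (size_mkseq (fun i => cell S (n - i.+1) 0) n))).
apply: cell_inj => i [|j] ij.
  rewrite addn0 ltnS in ij; rewrite cell_attach0//.
  case: (ltngtP i n) ij => [ii| |->] // _; last by rewrite subnn.
  have ni : (n - i.+1 < n)%N by lia.
  have -> : (n - i)%N = (n - i.+1).+1 by lia.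
  rewrite /= nth_mkseq//.
  by congr (cell S _ _); lia.
rewrite cell_attachS (@cell_finfun n (fun i j => cell S i j.+1))//.
by rewrite addnS ltnS in ij.
Qed.

Lemma big_tuple_cons (A : nmodType) (T : finType) n (F : seq T -> A) :
  \sum_(t : n.+1.-tuple T) F t = \sum_(x : T) \sum_(t : n.-tuple T) F (x :: t).
Proof.
rewrite pair_big /= (reindex (fun p : T * n.-tuple T => [tuple of p.1 :: p.2])) //=.
exists (fun t => (thead t, [tuple of behead t])) => [[x t] _|t _] /=.
  by congr (_, _); apply: val_inj.
by rewrite [RHS]tuple_eta.
Qed.

Lemma sum_option_letter (A : nmodType) (F : option letter -> A) :
  \sum_x F x =
  F None + (F (Some Alpha) + F (Some Gamma)) + (F (Some Beta) + F (Some Delta)).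
Proof.
have e : perm_eq (index_enum (option letter))
   [:: None; Some Alpha; Some Gamma; Some Beta; Some Delta].
  apply: uniq_perm => // [|x]; first exact: index_enum_uniq.
  by rewrite mem_index_enum; case: x => [[]|].
by rewrite (perm_big _ e) /= !big_cons big_nil addr0 !addrA.
Qed.

(** * Summation over the attached columns *)

Section generating_function.
Variable A : comNzRingType.
Implicit Types a b : A.

Lemma sum_all_empty n (F : seq (option letter) -> A) :
  \sum_(t : n.-tuple (option letter) | all (pred1 None) t) F t =
  F (nseq n None).
Proof.
rewrite (big_pred1 [tuple of nseq n None]) // => t /=; rewrite -val_eqE /=.
apply/idP/eqP => [|->]; last by rewrite all_nseq orbT.
by move/all_pred1P => ->; rewrite size_tuple.
Qed.

Lemma mask_update_empty m : mask_update m (nseq (size m) None) = m.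
Proof. by elim: m => //= c m; rewrite /mask_update /= andbT => ->. Qed.

(** The factor [b] stands for a bottom beta or delta, the extra power of [a] for a bottom alpha or
    gamma, above which all is empty; only their sum has a product form. A row that is not free must
    stay empty and changes nothing, while each free row multiplies the total by [a + b *+ 2]. *)
Lemma sum_columns a b (m : seq bool) :
  b * \sum_(t : (size m).-tuple (option letter) | column_ok m t)
    a ^+ count id (mask_update m t) * b ^+ count is_bd t
  + a ^+ (count id m).+1 = (a + b) * (a + b *+ 2) ^+ count id m.
Proof.
elim: m => [|c m IH] /=.
  rewrite (big_pred1 [tuple]) => [|t]; last by rewrite [t]tuple0 /= eqxx.
  rewrite /= !expr0; ring.
pose G t := a ^+ count id (mask_update m t) * b ^+ count is_bd t.
have {}IH : b * \sum_(t : (size m).-tuple (option letter) | column_ok m t) G t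
  + a ^+ (count id m).+1 = (a + b) * (a + b *+ 2) ^+ count id m by [].
rewrite big_mkcond /=.
rewrite (big_tuple_cons _ (fun t => if column_ok (c :: m) t then
  a ^+ count id (mask_update (c :: m) t) * b ^+ count is_bd t else 0)).
rewrite sum_option_letter /=.
have gN : \sum_(t : (size m).-tuple (option letter))
    (if column_ok m t then a ^+ (c && true + count id (mask_update m t)) *
       b ^+ (0 + count is_bd t) else 0) =
    a ^+ c * \sum_(t : (size m).-tuple (option letter) | column_ok m t) G t.
  rewrite -big_mkcond /= mulr_sumr; apply: eq_bigr => t _.
  by rewrite andbT exprD /G mulrA.
have gag : \sum_(t : (size m).-tuple (option letter))
    (if c && all (pred1 None) t then
       a ^+ (c && true + count id (mask_update m t)) * b ^+ (0 + count is_bd t)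
     else 0) = c%:R * a ^+ (c + count id m).
  rewrite -big_mkcond /=; case: c {gN} => /=; last by rewrite big_pred0// mul0r.
  rewrite (sum_all_empty _ (fun t => a ^+ (1 + count id (mask_update m t)) *
      b ^+ (0 + count is_bd t))) mask_update_empty mul1r.
  by rewrite count_nseq mulr1.
have gbd : \sum_(t : (size m).-tuple (option letter))
    (if c && column_ok m t then
       a ^+ (c && false + count id (mask_update m t)) * b ^+ (1 + count is_bd t)
     else 0) = c%:R * b *
       \sum_(t : (size m).-tuple (option letter) | column_ok m t) G t.
  case: c {gN gag} => /=; last by rewrite big1// !mul0r.
  rewrite -big_mkcond /= mul1r mulr_sumr; apply: eq_bigr => t _.
  by rewrite add0n exprD /G expr1; ring.
rewrite [X in X + (_ + _) + _]gN !gag !gbd.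
move: IH; set B := \sum_(t | _) _ => IH.
case: c {gN gag gbd} => /=.
  (* In a free row the three groups are: empty box, alpha or gamma (nothing above), beta or delta
     (the row stops being free). *)
  have -> : b * (a ^+ 1 * B + (1%:R * a ^+ (1 + count id m) + 1%:R * a ^+ (1 + count id m)) +
    (1%:R * b * B + 1%:R * b * B)) + a ^+ (1 + count id m).+1 =
    (a + b *+ 2) * (b * B + a ^+ (count id m).+1) by rewrite !add1n !exprS; ring.
  by rewrite IH add1n !exprS; ring.
by rewrite expr0 add0n -IH; ring.
Qed.

Lemma sum_bottom_columns a b (m : seq bool) :
  \sum_(x : option letter)
   \sum_(t : (size m).-tuple (option letter) | bottom_ok x m t)
    a ^+ (~~ is_bd x + count id (mask_update m t)) *
    b ^+ (is_bd x + count is_bd t) =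
  ((a + b) * (a + b *+ 2) ^+ count id m) *+ 2.
Proof.
rewrite sum_option_letter /= big_pred0//.
rewrite (sum_all_empty _ (fun t => a ^+ (1 + count id (mask_update m t)) *
      b ^+ (0 + count is_bd t))) mask_update_empty.
rewrite count_nseq !mulr1 -sum_columns add1n add0r.
have -> : \sum_(t : (size m).-tuple (option letter) | bottom_ok (Some Beta) m t)
    a ^+ (0 + count id (mask_update m t)) * b ^+ (1 + count is_bd t) =
  b * \sum_(t : (size m).-tuple (option letter) | column_ok m t)
    a ^+ count id (mask_update m t) * b ^+ count is_bd t.
  rewrite mulr_sumr; apply: eq_bigr => t _.
  by rewrite add0n exprD expr1; ring.
by ring.
Qed.

Lemma sum_attach n (F : filling n.+1 -> A) :
  \sum_S F S = \sum_(S : filling n) \sum_(x : option letter)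
    \sum_(t : n.-tuple (option letter)) F (attach_column S (x :: t)).
Proof.
under [RHS]eq_bigr do rewrite pair_big /=.
rewrite [RHS]pair_big /=.
pose h := fun p : filling n * (option letter * n.-tuple (option letter)) =>
  attach_column p.1 (p.2.1 :: p.2.2).
rewrite (reindex h) //=.
have hi : injective h.
  move=> [S [x t]] [S' [x' t']]; rewrite /h /= => /attach_inj.
  rewrite !size_tuple => /(_ erefl erefl)[-> -> tt'].
  by congr (_, (_, _)); apply: val_inj.
have hs S : exists p, h p == S.
  by have [S' [x [t ->]]] := attach_surj S; exists (S', (x, t)); apply/eqP.
exists (fun S => xchoose (hs S)) => [p _|S _].
  by apply: hi; apply/eqP/(xchooseP (hs (h p))).
exact/eqP/(xchooseP (hs S)).
Qed.

Definition tableau_gf n a b : A :=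
  \sum_(S : filling n | is_staircase S) a ^+ count id (row_mask S) * b ^+ num_bd S.

Lemma tableau_gfS n a b :
  tableau_gf n.+1 a b = ((a + b) * tableau_gf n (a + b *+ 2) b) *+ 2.
Proof.
rewrite /tableau_gf big_mkcond sum_attach.
rewrite mulr_sumr -sumrMnl [RHS]big_mkcond; apply: eq_bigr => S _.
transitivity (\sum_(x : option letter) \sum_(t : n.-tuple (option letter))
  (if is_staircase S && bottom_ok x (row_mask S) t then
    b ^+ num_bd S * (a ^+ (~~ is_bd x + count id (mask_update (row_mask S) t)) *
      b ^+ (is_bd x + count is_bd t)) else 0)).
  apply: eq_bigr => x _; apply: eq_bigr => t _.
  rewrite attach_staircase ?size_tuple//; case: ifP => // _.
  rewrite row_mask_attach ?size_tuple// num_bd_attach ?size_tuple//=.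
  by rewrite -addnA [b ^+ (num_bd S + _)]exprD mulrCA.
case: (is_staircase S) => /=; last by apply: big1 => x _; apply: big1.
have := sum_bottom_columns a b (row_mask S).
rewrite size_mkseq => e.
transitivity (b ^+ num_bd S * (((a + b) * (a + b *+ 2) ^+ count id (row_mask S)) *+ 2));
  last by rewrite mulrnAr; congr (_ *+ 2); rewrite mulrCA [b ^+ _ * _]mulrC.
rewrite -e mulr_sumr; apply: eq_bigr => x _.
by rewrite -big_mkcond mulr_sumr.
Qed.

Lemma tableau_gf0 a b : tableau_gf 0 a b = 1.
Proof.
rewrite /tableau_gf (big_pred1 [ffun=> None]).
  rewrite /row_mask /= expr0 mul1r /num_bd.
  rewrite eq_card0 // => c; rewrite !inE.
  by have := box_bound c.
move=> S /=; have nb (c : box 0) : False by have := box_bound c.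
have -> : S = [ffun=> None] by apply/ffunP => c; have := nb c.
by rewrite eqxx; apply/staircaseP; split => // [i j j'|i i' j]; rewrite cell_out.
Qed.

Lemma tableau_gfE n a b :
  tableau_gf n a b = \prod_(k < n) ((a + b *+ (k.*2).+1) *+ 2).
Proof.
elim: n a => [|n IH] a; first by rewrite tableau_gf0 big_ord0.
rewrite tableau_gfS IH big_ord_recl /= -mulrnAl; congr (_ * _).
apply: eq_bigr => i _; rewrite /bump /= add1n doubleS.
by congr (_ *+ 2); rewrite -addrA -mulrnDr.
Qed.

End generating_function.

Lemma sum_tableau_bd (A : comNzRingType) n (x : A) :
  \sum_(S : staircase n) x ^+ num_bd (val S) =
  \prod_(k < n) ((1 + x *+ (k.*2).+1) *+ 2).
Proof.
rewrite -tableau_gfE /tableau_gf.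
under [RHS]eq_bigr do rewrite expr1n mul1r.
rewrite [RHS](reindex_omap (fun S : staircase n => val S) insub) /=; last first.
  by move=> S hS; rewrite insubT.
by apply: eq_bigl => S; rewrite valK eqxx (valP S).
Qed.

(** * Transposition of tableaux *)

Definition swap_letter (x : option letter) : option letter :=
  match x with
  | Some Alpha => Some Beta | Some Beta => Some Alpha
  | Some Gamma => Some Delta | Some Delta => Some Gamma
  | None => None
  end.

Lemma swap_letterK : involutive swap_letter. Proof. by case=> [[]|]. Qed.

(** Swapping the two classes of letters along with rows and columns makes the row rule and the
    column rule trade places. *)
Definition transpose n (S : filling n) : filling n :=
  [ffun b => swap_letter (cell S (col_of b) (row_of b))].

Lemma cell_transpose n (S : filling n) i j :
  cell (transpose S) i j = swap_letter (cell S j i).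
Proof.
have [ij|ij] := ltnP (i + j) n; last by rewrite !cell_out// addnC.
by rewrite (@cell_finfun n (fun i j => swap_letter (cell S j i))).
Qed.

Lemma transposeK n : involutive (@transpose n).
Proof. by move=> S; apply: cell_inj => i j _; rewrite !cell_transpose swap_letterK. Qed.

Lemma is_bd_swap x : is_bd (swap_letter x) = is_ag x.
Proof. by case: x => [[]|]. Qed.
Lemma is_ag_swap x : is_ag (swap_letter x) = is_bd x.
Proof. by case: x => [[]|]. Qed.

Lemma transpose_staircase n (S : filling n) :
  is_staircase S -> is_staircase (transpose S).
Proof.
move=> /staircaseP[h1 h2 h3]; apply/staircaseP.
split => [i j ij|i j j'|i i' j]; rewrite !cell_transpose.
- by rewrite addnC in ij; have := h1 _ _ ij; case: (cell S j i) => [[]|].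
- by rewrite is_bd_swap => h /(h3 _ _ _ h) ->.
- by rewrite is_ag_swap => h /(h2 _ _ _ h) ->.
Qed.

Definition staircase_transpose n (S : staircase n) : staircase n :=
  exist _ (transpose (val S)) (transpose_staircase (valP S)).

Lemma staircase_transposeK n : involutive (@staircase_transpose n).
Proof. by move=> S; apply: val_inj; rewrite /= transposeK. Qed.

Lemma num_bd_transpose n (S : filling n) :
  num_bd (transpose S) = #|[set b | is_ag (S b)]%SET|.
Proof.
rewrite /num_bd !sum_box_cell// exchange_big /=.
by do 2![apply: eq_bigr => ? _]; rewrite cell_transpose is_bd_swap.
Qed.

(** * Sums of independent Bernoulli variables *)

Section bernoulli_sums.
Variables (R : realFieldType) (p : nat -> R).

(* [bern_mean n h] is the expectation of [h (I_0 + ... + I_(n-1))] for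
   independent Bernoulli variables [I_k] of parameters [p k]. *)
Fixpoint bern_mean (n : nat) (h : nat -> R) : R :=
  if n is m.+1 then bern_mean m (fun i => (1 - p m) * h i + p m * h i.+1)
  else h 0%N.

Lemma eq_bern_mean n h h' : h =1 h' -> bern_mean n h = bern_mean n h'.
Proof. by elim: n h h' => [|n IH] h h' e /=; [exact: e|apply: IH => i; rewrite !e]. Qed.

Lemma bern_meanD n h h' :
  bern_mean n (fun i => h i + h' i) = bern_mean n h + bern_mean n h'.
Proof.
elim: n h h' => [|n IH] h h' //=; rewrite -IH.
by apply: eq_bern_mean => i; rewrite !mulrDr addrACA.
Qed.

Lemma bern_mean_cst n c : bern_mean n (fun=> c) = c.
Proof.
elim: n => [|n IH] //=; rewrite -[RHS]IH.
by apply: eq_bern_mean => i; rewrite -mulrDl subrK mul1r.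
Qed.

Hypothesis p01 : forall k, 0 <= p k <= 1.

Lemma ler_bern_mean n h h' : (forall i, h i <= h' i) ->
  bern_mean n h <= bern_mean n h'.
Proof.
elim: n h h' => [|n IH] h h' hh //=; apply: IH => i.
have /andP[? ?] := p01 n.
by apply: lerD; apply: ler_wpM2l => //; rewrite subr_ge0.
Qed.

Lemma bern_mean_id n : bern_mean n (fun i => i%:R) = \sum_(k < n) p k.
Proof.
elim: n => [|n IH] /=; first by rewrite big_ord0.
rewrite big_ord_recr /= -IH -[X in _ = _ + X](bern_mean_cst n) -bern_meanD.
by apply: eq_bern_mean => i; rewrite -natr1; ring.
Qed.

(** The centre [m] is left free because integrating out the last summand moves it to [m - p n]. *)
Lemma bern_mean_var n m :
  bern_mean n (fun i => (i%:R - m) ^+ 2) =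
  \sum_(k < n) p k * (1 - p k) + (\sum_(k < n) p k - m) ^+ 2.
Proof.
elim: n m => [|n IH] m /=; first by rewrite !big_ord0; ring.
rewrite !big_ord_recr /=.
transitivity (bern_mean n (fun i => (i%:R - (m - p n)) ^+ 2) + p n * (1 - p n)).
  rewrite -[X in _ = _ + X](bern_mean_cst n) -bern_meanD.
  by apply: eq_bern_mean => i; rewrite -natr1; ring.
by rewrite IH; ring.
Qed.

(** * Generating polynomials of Bernoulli sums *)

Definition coef_pairing N (h : nat -> R) (P : {poly R}) : R :=
  \sum_(i < N) P`_i * h i.

Lemma coef_pairing_sum N h (I : finType) (F : I -> {poly R}) :
  coef_pairing N h (\sum_i F i) = \sum_i coef_pairing N h (F i).
Proof.
rewrite /coef_pairing exchange_big /=; apply: eq_bigr => i _.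
by rewrite coef_sum mulr_suml.
Qed.

Lemma coef_pairingZ N h c P : coef_pairing N h (c *: P) = c * coef_pairing N h P.
Proof.
by rewrite /coef_pairing mulr_sumr; apply: eq_bigr => i _; rewrite coefZ mulrA.
Qed.

Lemma coef_pairingXn N h d : (d < N)%N -> coef_pairing N h 'X^d = h d.
Proof.
move=> dN; rewrite /coef_pairing (bigD1 (Ordinal dN)) //= coefXn eqxx mul1r.
rewrite big1 ?addr0// => i; rewrite -val_eqE /= => /negbTE id.
by rewrite coefXn id mul0r.
Qed.

Definition bern_gf n : {poly R} := \prod_(k < n) ((1 - p k)%:P + p k *: 'X).

Lemma size_bern_gf n : (size (bern_gf n) <= n.+1)%N.
Proof.
elim: n => [|n IH]; first by rewrite /bern_gf big_ord0 size_poly1.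
rewrite /bern_gf big_ord_recr /=; apply: leq_trans (size_polyMleq _ _) _.
have : (size ((1 - p n)%:P + p n *: 'X)%R <= 2)%N.
  apply: leq_trans (size_polyD _ _) _; rewrite geq_max.
  rewrite (leq_trans (size_polyC_leq1 _))//=.
  by rewrite (leq_trans (size_scale_leq _ _))// size_polyX.
move=> h2; rewrite -subn1 leq_subLR; apply: leq_trans (leq_add IH h2) _.
by rewrite addn2.
Qed.

(** The pairing is the linear functional sending ['X^d] to [h d] for [d < N]. Multiplication by a
    factor of [bern_gf] is adjoint to the averaging of [h] in [bern_mean], and [n < N] ensures that
    no coefficient is cut off. *)
Lemma coef_pairing_bern_gf N n h : (n < N)%N ->
  coef_pairing N h (bern_gf n) = bern_mean n h.
Proof.
elim: n N h => [|n IH] N h.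
  by move=> N0; rewrite /bern_gf big_ord0 -(expr0 'X) coef_pairingXn.
case: N => [//|N]; rewrite ltnS => nN /=; rewrite -(IH N)//.
rewrite /bern_gf big_ord_recr /= -/(bern_gf n) /coef_pairing.
have cE i : (bern_gf n * ((1 - p n)%:P + p n *: 'X))`_i =
    (1 - p n) * (bern_gf n)`_i + p n * (if i is j.+1 then (bern_gf n)`_j else 0).
  rewrite mulrDr coefD mulrC coefCM -scalerAr coefZ coefMX.
  by case: i.
under eq_bigr do rewrite cE mulrDl.
rewrite big_split /=.
(* The first sum loses its last term, by degree, and the second its first term; both then run over
   [N] indices and can be merged. *)
rewrite big_ord_recr /= nth_default; last exact: leq_trans (size_bern_gf n) _.
rewrite mulr0 mul0r addr0 big_ord_recl /= mulr0 mul0r add0r -big_split /=.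
by apply: eq_bigr => i _; rewrite /bump /= add1n; ring.
Qed.

(** The expansion of the product [bern_gf n] gives the explicit product law on the cube, to be
    compared with independent indicators. *)
Lemma bern_mean_expand n h :
  bern_mean n h = \sum_(b : {ffun 'I_n -> bool})
    (\prod_(k < n) if b k then p k else 1 - p k) * h (\sum_(k < n) b k)%N.
Proof.
rewrite -(coef_pairing_bern_gf h (ltnSn n)).
have -> : bern_gf n = \sum_(b : {ffun 'I_n -> bool})
    (\prod_(k < n) if b k then p k else 1 - p k) *: 'X^(\sum_(k < n) b k)%N.
  transitivity (\prod_(k < n) \sum_(c : bool)
      ((if c then p k else 1 - p k) *: 'X^c : {poly R})).
    apply: eq_bigr => k _; rewrite big_bool /= addrC expr0 expr1.
    by rewrite -[in LHS]alg_polyC.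
  rewrite bigA_distr_bigA /=; apply: eq_bigr => b _.
  by rewrite scaler_prod -expr_sum.
rewrite coef_pairing_sum; apply: eq_bigr => b _.
rewrite coef_pairingZ coef_pairingXn// ltnS.
rewrite -[X in (_ <= X)%N]card_ord -sum1_card leq_sum// => k _; exact: leq_b1.
Qed.

End bernoulli_sums.

(** * Tableau statistics as Bernoulli sums *)

Section tableau_law.
Variable R : realFieldType.

Definition staircase_prob (k : nat) : R := 1 - (2 * k.+1%:R)^-1.

Lemma staircase_prob01 k : 0 <= staircase_prob k <= 1.
Proof.
have k1 : 1 <= k.+1%:R :> R by rewrite ler1n.
rewrite /staircase_prob subr_ge0 gerBl invr_ge0 invf_le1; [lra|lra].
Qed.

(** At the indeterminate ['X], [sum_tableau_bd] is a polynomial identity whose coefficients count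
    tableaux, so it can be paired with any [h]. Each factor normalises as [2 (1 + (2 k + 1) X) = 4
    (k + 1) ((1 - p) + p X)] with [p = staircase_prob k]. *)
Lemma sum_tableau n (h : nat -> R) :
  \sum_(S : staircase n) h (num_bd (val S)) =
  (\prod_(k < n) (4 * k.+1%:R)) * bern_mean staircase_prob n h.
Proof.
(* [N] exceeds both the degree of [bern_gf] and the number of boxes, so the pairing truncates
   neither side. *)
pose N := (n + #|{: box n}|).+1.
have szN (S : filling n) : (num_bd S < N)%N.
  by rewrite ltnS (leq_trans (max_card _))// leq_addl.
transitivity (coef_pairing N h (\sum_(S : staircase n) 'X^(num_bd (val S)))).
  by rewrite coef_pairing_sum; apply: eq_bigr => S _; rewrite coef_pairingXn.
rewrite sum_tableau_bd.
have -> : \prod_(k < n) ((1 + 'X *+ (k.*2).+1) *+ 2) =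
    (\prod_(k < n) (4 * k.+1%:R)) *: bern_gf staircase_prob n :> {poly R}.
  rewrite /bern_gf -scaler_prod; apply: eq_bigr => k _.
  have k0 : k.+1%:R != 0 :> R by rewrite pnatr_eq0.
  rewrite scalerDr -[in RHS]alg_polyC !scalerA.
  have -> : 4 * k.+1%:R * (1 - staircase_prob k) = 2.
    by rewrite /staircase_prob; field; rewrite addrC natr1.
  have -> : 4 * k.+1%:R * staircase_prob k = ((k.*2).+1 * 2)%:R.
    rewrite /staircase_prob natrM -[(k.*2).+1%:R]natr1 -mul2n natrM.
    by field; rewrite addrC natr1.
  by rewrite mulrnDl -mulrnA !scaler_nat.
by rewrite coef_pairingZ coef_pairing_bern_gf// ltnS leq_addr.
Qed.

Lemma card_staircase n : #|{: staircase n}|%:R = \prod_(k < n) (4 * k.+1%:R) :> R.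
Proof.
have := sum_tableau n (fun=> 1); rewrite bern_mean_cst mulr1 => <-.
by rewrite -sum1_card natr_sum.
Qed.

Lemma mean_tableau_bd n (h : nat -> R) :
  (\sum_(S : staircase n) h (num_bd (val S))) / #|{: staircase n}|%:R =
  bern_mean staircase_prob n h.
Proof.
rewrite sum_tableau -card_staircase mulrAC divff ?mul1r// card_staircase.
by apply/prodf_neq0 => k _; rewrite mulf_neq0 ?pnatr_eq0.
Qed.

Lemma mean_tableau_ag n (h : nat -> R) :
  (\sum_(S : staircase n) h #|[set b | is_ag (val S b)]%SET|) / #|{: staircase n}|%:R =
  bern_mean staircase_prob n h.
Proof.
rewrite -mean_tableau_bd; congr (_ / _).
rewrite [RHS](reindex_inj (inv_inj (@staircase_transposeK n))).
by apply: eq_bigr => S _; rewrite /= num_bd_transpose.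
Qed.

End tableau_law.

(** * Normal distribution function and heat flow *)

Section taylor_bounds.
Variable R : realType.
Implicit Types (f df d2f d3f : R -> R) (a b K : R).

(** The endpoints come in either order, since the increments in space have both signs. *)
Definition between a b x : Prop := Num.min a b <= x <= Num.max a b.

Lemma betweenL a b : between a b a.
Proof. by rewrite /between ge_min le_max lexx. Qed.

Lemma between_trans a b x y : between a b x -> between a x y -> between a b y.
Proof.
rewrite /between => /andP[h1 h2] /andP[h3 h4]; apply/andP; split.
  by apply: le_trans h3; rewrite le_min h1 ge_min lexx.
by apply: le_trans h4 _; rewrite ge_max h2 le_max lexx.
Qed.

Lemma between_dist a b x : between a b x -> `|x - a| <= `|b - a|.
Proof.
rewrite /between; have [ab|ba] := leP a b => /andP[h1 h2].
  by rewrite !ger0_norm ?subr_ge0// lerD2r.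
by rewrite !ler0_norm ?subr_le0 ?lerN2 ?lerD2r// ltW.
Qed.

Lemma ler_dist_deriv f df a b K :
  (forall x, between a b x -> is_derive x 1 f (df x)) ->
  (forall x, between a b x -> `|df x| <= K) ->
  `|f b - f a| <= K * `|b - a|.
Proof.
wlog ab : a b / a <= b => [hw|] fdf fK.
  have [ab|/ltW ba] := leP a b; first exact: hw.
  have e x : between b a x -> between a b x by rewrite /between minC maxC.
  rewrite distrC [X in _ * X]distrC; apply: hw => // x /e; [exact: fdf|exact: fK].
have btw x : x \in `[a, b] -> between a b x.
  by rewrite in_itv /= /between min_l// max_r.
have [x xab ->] : exists2 x, x \in `[a, b] & f b - f a = df x * (b - a).
  apply: MVT_segment => // [x xab|].
    by apply: fdf; apply: btw; apply: subset_itv_oo_cc.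
  apply: derivable_within_continuous => x xab.
  by have [] := fdf _ (btw _ xab).
by rewrite normrM ler_wpM2r// fK//; exact: btw.
Qed.

(** The mean value inequality is applied to [f] minus its linear part, then to [df]. This loses a
    factor 2 on the sharp constant, which is harmless for a limit theorem. *)
Lemma taylor1 f df d2f a b K :
  (forall x, between a b x -> is_derive x 1 f (df x)) ->
  (forall x, between a b x -> is_derive x 1 df (d2f x)) ->
  (forall x, between a b x -> `|d2f x| <= K) ->
  `|f b - f a - df a * (b - a)| <= K * `|b - a| ^+ 2.
Proof.
move=> fdf dfd2f d2fK.
have K0 : 0 <= K by apply: le_trans (d2fK a (betweenL a b)).
pose g x := f x - df a * (x - a).
have -> : f b - f a - df a * (b - a) = g b - g a by rewrite /g subrr; ring.
rewrite expr2 mulrA; apply: (@ler_dist_deriv g (fun x => df x - df a)) => x xab.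
  rewrite /g; have h := fdf _ xab.
  have -> : (fun x => f x - df a * (x - a)) = f - df a \*: (id - cst a) by [].
  by apply: is_derive_eq; rewrite subr0 /GRing.scale /= mulr1.
apply: le_trans (@ler_dist_deriv df d2f a x K _ _) _ => [y /(between_trans xab)|y /(between_trans xab)|].
- exact: dfd2f.
- exact: d2fK.
- by rewrite ler_wpM2l// between_dist.
Qed.

Lemma taylor2 f df d2f d3f a b K :
  (forall x, between a b x -> is_derive x 1 f (df x)) ->
  (forall x, between a b x -> is_derive x 1 df (d2f x)) ->
  (forall x, between a b x -> is_derive x 1 d2f (d3f x)) ->
  (forall x, between a b x -> `|d3f x| <= K) ->
  `|f b - f a - df a * (b - a) - d2f a * (b - a) ^+ 2 / 2| <= K * `|b - a| ^+ 3.
Proof.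
move=> fdf dfd2f d2fd3f d3fK.
have K0 : 0 <= K by apply: le_trans (d3fK a (betweenL a b)).
pose g x := f x - df a * (x - a) - (d2f a / 2) * (x - a) ^+ 2.
have -> : f b - f a - df a * (b - a) - d2f a * (b - a) ^+ 2 / 2 = g b - g a.
  by rewrite /g subrr; field.
rewrite exprSr mulrA.
apply: (@ler_dist_deriv g (fun x => df x - df a - d2f a * (x - a))) => x xab.
  rewrite /g; have h := fdf _ xab.
  have -> : (fun x => f x - df a * (x - a) - d2f a / 2 * (x - a) ^+ 2) =
     f - df a \*: (id - cst a) - (d2f a / 2) \*: ((id - cst a) ^+ 2) by [].
  apply: is_derive_eq; rewrite subr0 /GRing.scale /= !fctE expr1 !mulr1.
  by field.
apply: le_trans (@taylor1 df d2f d3f a x K _ _ _) _ =>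
  [y /(between_trans xab)|y /(between_trans xab)|y /(between_trans xab)|].
- exact: dfd2f.
- exact: d2fd3f.
- exact: d3fK.
- by rewrite ler_wpM2l// lerXn2r ?nnegrE// between_dist.
Qed.

End taylor_bounds.

(** * The normal distribution function and bounds on its derivatives *)

Section normal_cdf.
Variable R : realType.

Definition Phi (x : R) : R := fine (normal_prob 0 1 `]-oo, x]%classic).
Definition phi (x : R) : R := normal_pdf 0 1 x.

Lemma PhiE (x : R) : (Phi x)%:E = normal_prob 0 1 `]-oo, x]%classic.
Proof. by rewrite fineK// fin_num_measure. Qed.

(** The identity, as a random variable under the normal law, makes [Phi] a [cdf], whence its
    monotonicity and its limits. *)
Let idTR : measurableTypeR R -> R := idfun.

#[local] HB.instance Definition _ :=
  @isMeasurableFun.Build _ _ _ _ idTR (@measurable_id _ _ setT).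

Let idn : {RV (normal_prob (0 : R) 1) >-> R} := idTR.

Lemma cdf_normal (x : R) : cdf idn x = (Phi x)%:E.
Proof. by rewrite PhiE /cdf /distribution /= /pushforward. Qed.

Lemma Phi_nondecreasing : {homo Phi : x y / x <= y}.
Proof. by move=> x y xy; rewrite -lee_fin -!cdf_normal; exact: cdf_nondecreasing. Qed.

Lemma Phi_ge0 x : 0 <= Phi x.
Proof. by rewrite -lee_fin PhiE measure_ge0. Qed.

Lemma Phi_le1 x : Phi x <= 1.
Proof. by rewrite -lee_fin -cdf_normal cdf_le1. Qed.

Lemma cvg_Phi_pinfty : Phi x @[x --> +oo] --> (1 : R).
Proof.
have -> : Phi = fine \o cdf idn by apply/funext => x; rewrite /comp cdf_normal.
exact/fine_cvg/cvg_cdfy1.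
Qed.

Lemma cvg_Phi_ninfty : Phi x @[x --> -oo] --> (0 : R).
Proof.
have -> : Phi = fine \o cdf idn by apply/funext => x; rewrite /comp cdf_normal.
exact/fine_cvg/cvg_cdfNy0.
Qed.

Lemma is_derive_Phi (x : R) : is_derive x 1 Phi (phi x).
Proof.
have xx1 : x < x + 1 by rewrite ltrDl.
have intf : lebesgue_measure.-integrable [set` Interval -oo%O (BRight (x + 1))]
    (EFin \o normal_pdf 0 1).
  by apply: (integrableS _ _ (subsetT _)) => //; exact: integrable_normal_pdf.
have [d e] := continuous_FTC1 xx1 intf (ltNyr _)
  (continuous_normal_pdf (oner_neq0 _) (x := x)).
by split; [exact: d|rewrite -derive1E; exact: e].
Qed.

Lemma phiE x : phi x = normal_peak 1 * expR (- (x ^+ 2 / 2)).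
Proof.
by rewrite /phi normal_pdfE ?oner_neq0// /normal_fun subr0 expr1n mulNr.
Qed.

Lemma is_derive_phi (x : R) : is_derive x 1 phi (- x * phi x).
Proof.
have -> : phi = normal_peak 1 \*: (expR \o ((- 2^-1 : R) \*: (id ^+ 2))).
  apply/funext => y; rewrite phiE !fctE /= /GRing.scale /=.
  by congr (_ * expR _); field.
apply: is_derive_eq; rewrite /GRing.scale /= !fctE /= /GRing.scale /=.
by field.
Qed.

Lemma normal_peak_le1 : normal_peak 1 <= 1 :> R.
Proof.
rewrite /normal_peak expr1n mul1r -[leRHS]invr1 lef_pV2 ?posrE//.
  rewrite -[leLHS]sqrtr1 ler_wsqrtr//.
  by have := pi_ge2 R; rewrite mulr2n; lra.
by rewrite sqrtr_gt0; have := pi_gt0 R; rewrite mulr2n; lra.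
Qed.

Lemma phi_ge0 x : 0 <= phi x.
Proof. exact: normal_pdf_ge0. Qed.

Lemma phi_le_expR x : phi x <= expR (- (x ^+ 2 / 2)).
Proof. by rewrite phiE ler_piMl ?expR_ge0 ?normal_peak_le1. Qed.

Lemma phi_le1 x : phi x <= 1.
Proof.
apply: le_trans (phi_le_expR x) _; rewrite -[leRHS]expR0 ler_expR.
by rewrite oppr_le0 divr_ge0 ?sqr_ge0.
Qed.

(** This is [t <= expR t] at [t = x ^+ 2 / 2]. *)
Lemma sqr_phi_le x : x ^+ 2 * phi x <= 2.
Proof.
apply: le_trans (ler_wpM2l (sqr_ge0 x) (phi_le_expR x)) _.
rewrite expRN ler_pdivrMr ?expR_gt0//.
by have := expR_ge1Dx (x ^+ 2 / 2); lra.
Qed.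

(** This is the square of [t <= expR t] at [t = x ^+ 2 / 4]. *)
Lemma quartic_phi_le x : x ^+ 4 * phi x <= 16.
Proof.
have x4 : 0 <= x ^+ 4 by rewrite (exprM x 2 2) sqr_ge0.
apply: le_trans (ler_wpM2l x4 (phi_le_expR x)) _.
rewrite expRN ler_pdivrMr ?expR_gt0//.
have -> : expR (x ^+ 2 / 2) = expR (x ^+ 2 / 4) ^+ 2.
  by rewrite -expRM_natl; congr expR; field.
have h := expR_ge1Dx (x ^+ 2 / 4).
have : (x ^+ 2 / 4) ^+ 2 <= expR (x ^+ 2 / 4) ^+ 2.
  rewrite lerXn2r ?nnegrE ?expR_ge0 ?divr_ge0 ?sqr_ge0//.
  by apply: le_trans h; rewrite lerDr.
rewrite expr_div_n -exprM => h2; lra.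
Qed.

Lemma norm_le_1Dsqr (x : R) : `|x| <= 1 + x ^+ 2.
Proof. by rewrite -real_normK ?num_real//; have := normr_ge0 x; nra. Qed.

Definition dphi (x : R) : R := - x * phi x.
Definition d2phi (x : R) : R := (x ^+ 2 - 1) * phi x.

Lemma is_derive_dphi (x : R) : is_derive x 1 dphi (d2phi x).
Proof.
have h := is_derive_phi x.
have -> : dphi = - id * phi by [].
by apply: is_derive_eq; rewrite /d2phi /GRing.scale /= !fctE; ring.
Qed.

Lemma dphi_le x : `|dphi x| <= 3.
Proof.
rewrite /dphi normrM normrN (ger0_norm (phi_ge0 x)).
apply: le_trans (ler_wpM2r (phi_ge0 x) (norm_le_1Dsqr x)) _.
by rewrite mulrDl mul1r; have := phi_le1 x; have := sqr_phi_le x; lra.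
Qed.

Lemma d2phi_le x : `|d2phi x| <= 3.
Proof.
rewrite /d2phi normrM (ger0_norm (phi_ge0 x)).
have : `|x ^+ 2 - 1| <= 1 + x ^+ 2.
  by rewrite ler_norml; have := sqr_ge0 x; lra.
move=> /(ler_wpM2r (phi_ge0 x)) /le_trans; apply.
by rewrite mulrDl mul1r; have := phi_le1 x; have := sqr_phi_le x; lra.
Qed.

Lemma idM_d2phi_le x : `|x * d2phi x| <= 21.
Proof.
rewrite /d2phi mulrA normrM (ger0_norm (phi_ge0 x)).
have : `|x * (x ^+ 2 - 1)| <= 1 + 2 * x ^+ 2 + x ^+ 4.
  rewrite normrM.
  have h1 : `|x ^+ 2 - 1| <= 1 + x ^+ 2.
    by rewrite ler_norml; have := sqr_ge0 x; lra.
  apply: le_trans (ler_pM (normr_ge0 _) (normr_ge0 _) (norm_le_1Dsqr x) h1) _.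
  by rewrite le_eqVlt; apply/orP; left; apply/eqP; ring.
move=> /(ler_wpM2r (phi_ge0 x)) /le_trans; apply.
rewrite !mulrDl mul1r -mulrA.
by have := phi_le1 x; have := sqr_phi_le x; have := quartic_phi_le x; lra.
Qed.

End normal_cdf.

(** * Heat flow and the replacement of Bernoulli summands *)

Section heat_flow.
Variable R : realType.
Implicit Types s y d e : R.

Definition heat s y : R := Phi (y / Num.sqrt s).

Definition inv_sqrt s : R := (Num.sqrt s)^-1.

Lemma is_derive_comp_scale (f : R -> R) df r y :
  is_derive (y * r) 1 f df -> is_derive y 1 (fun z => f (z * r)) (df * r).
Proof.
move=> h.
have -> : (fun z => f (z * r)) = f \o (r \*: id).
  by apply/funext => z; rewrite /= /GRing.scale /= mulrC.
have e : (r \*: id : R -> R) y = y * r by rewrite /= /GRing.scale /= mulrC.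
apply: (@is_derive1_comp _ f (r \*: id)); first by rewrite e.
by apply: is_derive_eq; rewrite /GRing.scale /= mulr1.
Qed.

(** Each derivative in [y] brings out one factor [inv_sqrt s]; the constant 3 is the bound of
    [d2phi_le] on the third derivative of [Phi]. *)
Lemma heat_taylor_space s y a : 0 < s ->
  `|heat s (y + a) - heat s y - (phi (y * inv_sqrt s) * inv_sqrt s) * a
    - (dphi (y * inv_sqrt s) * inv_sqrt s * inv_sqrt s) * a ^+ 2 / 2| <= 3 * inv_sqrt s ^+ 3 * `|a| ^+ 3.
Proof.
move=> s0; set r := inv_sqrt s.
have r0 : 0 <= r by rewrite invr_ge0 sqrtr_ge0.
have := @taylor2 R (fun z => Phi (z * r)) (fun z => phi (z * r) * r)
  (fun z => dphi (z * r) * r * r) (fun z => d2phi (z * r) * r * r * r)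
  y (y + a) (3 * r ^+ 3).
rewrite [y + a - y]addrC addKr; apply => x _.
- exact/is_derive_comp_scale/is_derive_Phi.
- have h := is_derive_comp_scale (is_derive_phi (x * r)).
  have -> : (fun z => phi (z * r) * r) = r \*: (fun z => phi (z * r)).
    by apply/funext => z; rewrite /= /GRing.scale /= mulrC.
  by apply: is_derive_eq; rewrite /GRing.scale /= mulrC.
- have h := is_derive_comp_scale (is_derive_dphi (x * r)).
  have -> : (fun z => dphi (z * r) * r * r) = (r * r) \*: (fun z => dphi (z * r)).
    by apply/funext => z; rewrite /= /GRing.scale /= -mulrA mulrC.
  by apply: is_derive_eq; rewrite /GRing.scale /=; ring.
- have -> : d2phi (x * r) * r * r * r = d2phi (x * r) * r ^+ 3 by ring.
  rewrite normrM [`|r ^+ 3|]ger0_norm ?exprn_ge0//.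
  by apply: ler_wpM2r; [exact: exprn_ge0|exact: d2phi_le].
Qed.

Lemma is_derive_rs s : 0 < s -> is_derive s 1 inv_sqrt (- (inv_sqrt s ^+ 3 / 2)).
Proof.
move=> s0; have q0 : Num.sqrt s != 0 by rewrite gt_eqF// sqrtr_gt0.
have h := is_derive1_sqrt s0.
by apply: is_derive_eq (is_deriveV q0 h) _; rewrite /GRing.scale /= /inv_sqrt; field.
Qed.

(* The coefficient of [v] is half the second [y]-derivative of [heat]: this is
   the heat equation. *)
Lemma heat_taylor_time s y v : 0 < s -> 0 <= v ->
  `|heat (s + v) y - heat s y - (dphi (y * inv_sqrt s) * inv_sqrt s * inv_sqrt s) / 2 * v|
  <= 7 * inv_sqrt s ^+ 4 * v ^+ 2.
Proof.
move=> s0 v0.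
have btw x : between s (s + v) x -> s <= x.
  by rewrite /between min_l ?lerDl// => /andP[].
have hy (f : R -> R) df x : 0 < x -> is_derive (y * inv_sqrt x) 1 f df ->
    is_derive x 1 (fun z => f (y * inv_sqrt z)) (df * (y * - (inv_sqrt x ^+ 3 / 2))).
  move=> x0 h; apply: (@is_derive1_comp _ f (fun z => y * inv_sqrt z)) => //.
  by have hr := is_derive_rs x0; apply: is_derive_eq (is_deriveZ y hr) _.
have := @taylor1 R (fun z => Phi (y * inv_sqrt z))
  (fun z => dphi (y * inv_sqrt z) * inv_sqrt z * inv_sqrt z / 2)
  (fun z => - (dphi (y * inv_sqrt z) + (y * inv_sqrt z) * d2phi (y * inv_sqrt z) / 2) * inv_sqrt z ^+ 4 / 2)
  s (s + v) (7 * inv_sqrt s ^+ 4).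
rewrite [s + v - s]addrC addKr (ger0_norm v0); apply => x /btw sx;
  have x0 : 0 < x by exact: lt_le_trans sx.
- apply: is_derive_eq (hy _ _ _ x0 (is_derive_Phi _)) _.
  by rewrite /dphi; field.
- have h1 := hy _ _ _ x0 (is_derive_dphi (y * inv_sqrt x)).
  have h2 := is_derive_rs x0.
  have -> : (fun z => dphi (y * inv_sqrt z) * inv_sqrt z * inv_sqrt z / 2) =
      2^-1 \*: ((fun z => dphi (y * inv_sqrt z)) * inv_sqrt * inv_sqrt).
    by apply/funext => z; rewrite /= /GRing.scale /= mulrC.
  by apply: is_derive_eq; rewrite /GRing.scale /= !fctE; field.
- have rx : 0 <= inv_sqrt x by rewrite invr_ge0 sqrtr_ge0.
  have rxs : inv_sqrt x <= inv_sqrt s.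
    by rewrite lef_pV2 ?posrE ?sqrtr_gt0// ler_wsqrtr.
  have r4 : inv_sqrt x ^+ 4 <= inv_sqrt s ^+ 4 by rewrite lerXn2r ?nnegrE// (le_trans rx).
  rewrite -mulrA normrM normrN [`|_ ^+ 4 / 2|]ger0_norm ?divr_ge0 ?exprn_ge0//.
  (* By [dphi_le] and [idM_d2phi_le] the first factor is at most [3 + 21 / 2], rounded up to 14. *)
  apply: le_trans (_ : 14 * (inv_sqrt x ^+ 4 / 2) <= _); last by lra.
  apply: ler_wpM2r; first by rewrite divr_ge0 ?exprn_ge0.
  apply: le_trans (ler_normD _ _) _.
  rewrite [`|_ / 2|]normrM [`|2^-1|]ger0_norm ?invr_ge0//.
  have := dphi_le (y * inv_sqrt x); have := idM_d2phi_le (y * inv_sqrt x); lra.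
Qed.

(** The two Taylor constants at time [d]; as [inv_sqrt] decreases, they serve at every time
    [s >= d]. *)
Definition heat_cst d : R := 3 * inv_sqrt d ^+ 3 + 7 * inv_sqrt d ^+ 4.

Lemma heat_cst_ge0 d : 0 <= heat_cst d.
Proof.
have r0 : 0 <= inv_sqrt d by rewrite invr_ge0 sqrtr_ge0.
by rewrite addr_ge0// mulr_ge0// exprn_ge0.
Qed.

(** The two-point displacement is centred with variance [p * (1 - p) * e ^+ 2]. First order terms
    cancel, second order terms cancel against the time increment by the heat equation, and only the
    three Taylor remainders are left. *)
Lemma heat_bern_step d s y (p : R) e : 0 < d -> d <= s -> 0 <= p <= 1 ->
  0 <= e <= 1 ->
  `|(1 - p) * heat s (y + p * e) + p * heat s (y - (1 - p) * e)
    - heat (s + p * (1 - p) * e ^+ 2) y| <= heat_cst d * (p * (1 - p) * e ^+ 3).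
Proof.
move=> d0 ds /andP[p0 p1] /andP[e0 e1].
have s0 : 0 < s by exact: lt_le_trans ds.
have v0 : 0 <= p * (1 - p) * e ^+ 2.
  by rewrite !mulr_ge0 ?subr_ge0 ?sqr_ge0.
have h1 := heat_taylor_space y (p * e) s0.
have h2 := heat_taylor_space y (- ((1 - p) * e)) s0.
have h3 := heat_taylor_time y s0 v0.
have q0 : 0 <= 1 - p by rewrite subr_ge0.
rewrite [`|p * e|]ger0_norm ?mulr_ge0// in h1.
rewrite normrN [`|(1 - p) * e|]ger0_norm ?mulr_ge0// in h2.
have rd : 0 <= inv_sqrt s by rewrite invr_ge0 sqrtr_ge0.
have rsd : inv_sqrt s <= inv_sqrt d by rewrite lef_pV2 ?posrE ?sqrtr_gt0// ler_wsqrtr.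
have r3 : inv_sqrt s ^+ 3 <= inv_sqrt d ^+ 3 by rewrite lerXn2r ?nnegrE// (le_trans rd).
have r4 : inv_sqrt s ^+ 4 <= inv_sqrt d ^+ 4 by rewrite lerXn2r ?nnegrE// (le_trans rd).
have r30 : 0 <= inv_sqrt s ^+ 3 by rewrite exprn_ge0.
have r40 : 0 <= inv_sqrt s ^+ 4 by rewrite exprn_ge0.
move: h1 h2 h3; rewrite /heat_cst.
set w := heat s y; set w1 := phi _ * _; set w2 := dphi _ * _ * _.
set A := heat s _; set B := heat s _; set C := heat (s + _) y.
move=> h1 h2 h3.
pose RA := A - w - w1 * (p * e) - w2 * (p * e) ^+ 2 / 2.
pose RB := B - w - w1 * (- ((1 - p) * e)) - w2 * (- ((1 - p) * e)) ^+ 2 / 2.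
pose RC := C - w - w2 / 2 * (p * (1 - p) * e ^+ 2).
have -> : (1 - p) * A + p * B - C = (1 - p) * RA + p * RB - RC.
  by rewrite /RA /RB /RC; field.
apply: le_trans (ler_normB _ _) _.
apply: le_trans (lerD (ler_normD _ _) (lexx _)) _.
rewrite !normrM (ger0_norm q0) (ger0_norm p0).
have k1 : (1 - p) * `|RA| <= (1 - p) * (3 * inv_sqrt s ^+ 3 * (p * e) ^+ 3).
  exact: (ler_wpM2l q0 h1).
have k2 : p * `|RB| <= p * (3 * inv_sqrt s ^+ 3 * ((1 - p) * e) ^+ 3).
  exact: (ler_wpM2l p0 h2).
apply: le_trans (lerD (lerD k1 k2) h3) _.
set X := p * (1 - p) * e ^+ 3.
have X0 : 0 <= X by rewrite /X !mulr_ge0 ?exprn_ge0.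
have -> : (1 - p) * (3 * inv_sqrt s ^+ 3 * (p * e) ^+ 3) +
    p * (3 * inv_sqrt s ^+ 3 * ((1 - p) * e) ^+ 3) =
    3 * inv_sqrt s ^+ 3 * X * (p ^+ 2 + (1 - p) ^+ 2) by rewrite /X; ring.
have -> : 7 * inv_sqrt s ^+ 4 * (p * (1 - p) * e ^+ 2) ^+ 2 =
    7 * inv_sqrt s ^+ 4 * X * (p * (1 - p) * e) by rewrite /X; ring.
(* The leftover factors [p ^+ 2 + (1 - p) ^+ 2] and [p * (1 - p) * e] are at most 1. *)
rewrite [(_ + _) * X]mulrDl; apply: lerD.
  apply: le_trans (_ : 3 * inv_sqrt s ^+ 3 * X <= _).
    by rewrite ler_piMr ?mulr_ge0//; nra.
  by rewrite ler_wpM2r// ler_wpM2l.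
apply: le_trans (_ : 7 * inv_sqrt s ^+ 4 * X <= _).
  by rewrite ler_piMr ?mulr_ge0// mulr_ile1 ?mulr_ge0//; nra.
by rewrite ler_wpM2r// ler_wpM2l.
Qed.

(* Lindeberg's telescoping: each step replaces one summand by heat flow. *)
Lemma bern_mean_heat (p : nat -> R) n d s y e : (forall k, 0 <= p k <= 1) ->
  0 < d -> d <= s -> 0 <= e <= 1 ->
  `|bern_mean p n (fun i => heat s (y - (i%:R - \sum_(k < n) p k) * e))
    - heat (s + (\sum_(k < n) p k * (1 - p k)) * e ^+ 2) y|
  <= heat_cst d * e ^+ 3 * \sum_(k < n) p k * (1 - p k).
Proof.
move=> p01 d0 + e01; elim: n s => [|n IH] s ds /=.
  by rewrite !big_ord0 mulr0n subrr !mul0r subr0 addr0 subrr normr0 mulr0.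
rewrite !big_ord_recr /=.
set m := \sum_(k < n) p k; set V := \sum_(k < n) _.
set v := p n * (1 - p n) * e ^+ 2.
have v0 : 0 <= v.
  have /andP[? ?] := p01 n; apply: mulr_ge0; last exact: sqr_ge0.
  by rewrite mulr_ge0// subr_ge0.
(* The last summand is integrated first and advances the time to [s + v], where the error constant
   at [d] is still valid. *)
have /IH {}IH : d <= s + v by rewrite (le_trans ds)// lerDl.
pose h i := (1 - p n) * heat s (y - (i%:R - (m + p n)) * e)
         + p n * heat s (y - (i.+1%:R - (m + p n)) * e).
pose h' i := heat (s + v) (y - (i%:R - m) * e).
have hh i : `|h i - h' i| <= heat_cst d * (p n * (1 - p n) * e ^+ 3).
  have := heat_bern_step (y - (i%:R - m) * e) d0 ds (p01 n) e01.
  rewrite -/v /h /h' -natr1.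
  have -> : y - (i%:R - m) * e + p n * e = y - (i%:R - (m + p n)) * e by ring.
  by have -> : y - (i%:R - m) * e - (1 - p n) * e = y - (i%:R + 1 - (m + p n)) * e
    by ring.
set K := heat_cst d * _ in hh.
(* A uniform bound on [h - h'] survives averaging, because [bern_mean] is monotone and fixes
   constants. *)
have hu : bern_mean p n h <= bern_mean p n h' + K.
  rewrite -[X in _ <= _ + X](bern_mean_cst p n) -bern_meanD.
  apply: ler_bern_mean => // i; have := hh i; rewrite ler_norml; lra.
have hl : bern_mean p n h' <= bern_mean p n h + K.
  rewrite -[X in _ <= _ + X](bern_mean_cst p n) -bern_meanD.
  apply: ler_bern_mean => // i; have := hh i; rewrite ler_norml; lra.
have -> : s + (V + p n * (1 - p n)) * e ^+ 2 = s + v + V * e ^+ 2.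
  by rewrite /v; ring.
have -> : heat_cst d * e ^+ 3 * (V + p n * (1 - p n)) =
   K + heat_cst d * e ^+ 3 * V by rewrite /K; ring.
have {}IH : `|bern_mean p n h' - heat (s + v + V * e ^+ 2) y| <=
    heat_cst d * e ^+ 3 * V by exact: IH.
have -> : bern_mean p n (fun i => (1 - p n) * heat s (y - (i%:R - (m + p n)) * e)
    + p n * heat s (y - (i.+1%:R - (m + p n)) * e)) = bern_mean p n h by [].
move: IH hu hl; set X := heat_cst d * e ^+ 3 * V.
move: (bern_mean p n h) (bern_mean p n h') (heat _ y) => E E' H.
by rewrite !ler_norml; lra.
Qed.

End heat_flow.

(** * Central limit theorem *)

Section staircase_clt.
Variable R : realType.
Local Notation p := (@staircase_prob R).

(** * Harmonic sums *)

Lemma H_E n : H_ R n = \sum_(k < n) k.+1%:R^-1.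
Proof. by rewrite /H_ big_add1 /= big_mkord. Qed.

Lemma H2_E n : H2_ R n = \sum_(k < n) (k.+1%:R ^+ 2)^-1.
Proof. by rewrite /H2_ big_add1 /= big_mkord. Qed.

Lemma sum_staircase_prob n : \sum_(k < n) p k = n%:R - H_ R n / 2.
Proof.
rewrite H_E mulr_suml /staircase_prob big_split /= sumr_const card_ord sumrN.
by congr (_ - _); apply: eq_bigr => k _; rewrite invfM mulrC.
Qed.

Lemma sum_staircase_var n :
  \sum_(k < n) p k * (1 - p k) = H_ R n / 2 - H2_ R n / 4.
Proof.
rewrite H_E H2_E !mulr_suml -sumrB; apply: eq_bigr => k _.
by rewrite /staircase_prob; field; rewrite addrC natr1 pnatr_eq0.
Qed.

(** Each step is [ln (1 + x) <= x] at [x = n.+1%:R^-1]. *)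
Lemma H_ge_ln n : ln n.+1%:R <= H_ R n.
Proof.
rewrite H_E; elim: n => [|n IH]; first by rewrite ln1 big_ord0.
rewrite big_ord_recr /=.
have n0 : 0 < n.+1%:R :> R by rewrite ltr0n.
have -> : n.+2%:R = n.+1%:R * (1 + n.+1%:R^-1) :> R.
  by rewrite mulrDr mulr1 divff ?gt_eqF// natr1.
rewrite lnM ?posrE// ?addr_gt0 ?invr_gt0// lerD//.
by apply: le_ln1Dx; rewrite (lt_trans _ (_ : 0 < _)) ?invr_gt0// ltrN10.
Qed.

(** Each step is [ln (1 + x) <= x] at [x = - n.+2%:R^-1]. *)
Lemma H_le_ln n : (0 < n)%N -> H_ R n <= 1 + ln n%:R.
Proof.
rewrite H_E; case: n => // n _; elim: n => [|n IH].
  by rewrite big_ord1 invr1 ln1 addr0.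
rewrite big_ord_recr /=; apply: le_trans (lerD IH (lexx _)) _.
have n0 : 0 < n.+1%:R :> R by rewrite ltr0n.
have n1 : 0 < n.+2%:R :> R by rewrite ltr0n.
have n1V : n.+2%:R^-1 < 1 :> R by rewrite invf_lt1// ltr1n.
have nE : n.+1%:R = n.+2%:R * (1 - n.+2%:R^-1) :> R.
  by rewrite mulrBr mulr1 divff ?gt_eqF// -[n.+2%:R]natr1 addrK.
rewrite [in X in X <= _]nE lnM ?posrE// ?subr_gt0// -!addrA lerD2l gerDl.
rewrite -lerBrDr sub0r; apply: le_ln1Dx; rewrite ltrN2.
exact: n1V.
Qed.

Lemma H2_ge0 n : 0 <= H2_ R n.
Proof. by rewrite H2_E sumr_ge0// => k _; rewrite invr_ge0 sqr_ge0. Qed.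

Lemma H2_le2 n : H2_ R n <= 2.
Proof.
(* The sharper bound makes the induction close, since [1 / (x + 1) ^ 2 <= 1 / x - 1 / (x + 1)]. *)
suff h m : \sum_(k < m.+1) (k.+1%:R ^+ 2)^-1 <= 2 - m.+1%:R^-1 :> R.
  rewrite H2_E; case: n => [|n]; first by rewrite big_ord0.
  by apply: le_trans (h n) _; rewrite gerBl invr_ge0.
elim: m => [|n' IH]; first by rewrite big_ord1 expr1n invr1; lra.
rewrite big_ord_recr /=; apply: le_trans (lerD IH (lexx _)) _.
have n0 : 0 < n'.+1%:R :> R by rewrite ltr0n.
rewrite -[n'.+2%:R]natr1; set x := n'.+1%:R in n0 *.
rewrite -subr_ge0.
have -> : 2 - (x + 1)^-1 - (2 - x^-1 + ((x + 1) ^+ 2)^-1) =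
   (x * (x + 1) ^+ 2)^-1 by field; rewrite !gt_eqF// addr_gt0.
by rewrite invr_ge0 mulr_ge0 ?sqr_ge0// ltW.
Qed.

(** * Normalisation: scale, drift and variance *)

Definition clt_scale (n : nat) : R := (Num.sqrt (ln n%:R / 2))^-1.

Lemma cvg_clt_scale : clt_scale n @[n --> \oo] --> (0 : R).
Proof.
apply/cvgr0Pnorm_lt => e e0; near=> n.
have Ln : 2 * e ^- 2 < ln n%:R.
  rewrite -ltr_expR lnK; first by near: n; exact: nbhs_infty_gtr.
  by rewrite posrE; near: n; exact: nbhs_infty_gtr.
have L0 : 0 < ln n%:R / 2 :> R.
  by rewrite divr_gt0// (lt_trans _ Ln)// mulr_gt0// invr_gt0 exprn_gt0.
rewrite ger0_norm ?invr_ge0 ?sqrtr_ge0// /clt_scale.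
rewrite -[ltRHS]invrK ltf_pV2 ?posrE ?invr_gt0 ?sqrtr_gt0//.
rewrite -[ltLHS]ger0_norm ?invr_ge0 ?(ltW e0)// -sqrtr_sqr ltr_sqrt//.
by rewrite exprVn; lra.
Unshelve. all: by end_near. Qed.

(** At [n = 1] the logarithm vanishes and the scale is 0, so these relations hold only
    eventually. *)
Lemma near_clt_scale : \forall n \near \oo,
  [/\ (0 < n)%N, 0 < clt_scale n & clt_scale n ^+ 2 * (ln n%:R / 2) = 1].
Proof.
near=> n.
have n1 : (1 < n)%N by near: n; exact: nbhs_infty_gt.
have L0 : 0 < ln n%:R / 2 :> R by rewrite divr_gt0// ln_gt0// ltr1n.
split; first exact: ltnW.
- by rewrite invr_gt0 sqrtr_gt0.
- by rewrite exprVn sqr_sqrtr ?ltW// mulVf// gt_eqF.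
Unshelve. all: by end_near. Qed.

(** The first factor is half of [ln n - H_n], which stays bounded, and the scale tends to 0. *)
Lemma cvg_clt_drift :
  (\sum_(k < n) p k - n%:R + ln n%:R / 2) * clt_scale n @[n --> \oo] --> (0 : R).
Proof.
apply/cvgr0Pnorm_le => e e0; near=> n.
have [n0 s0 _] : [/\ (0 < n)%N, 0 < clt_scale n &
    clt_scale n ^+ 2 * (ln n%:R / 2) = 1] by near: n; exact: near_clt_scale.
have se : `|clt_scale n| <= e.
  by near: n; move/cvgr0Pnorm_le : cvg_clt_scale; apply.
rewrite ger0_norm ?(ltW s0)// in se.
have h1 : ln n%:R <= H_ R n.
  apply: le_trans (H_ge_ln n); rewrite ler_ln ?posrE ?ltr0n// ler_nat//.
have h2 := H_le_ln n0.
rewrite sum_staircase_prob normrM (gtr0_norm s0).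
apply: le_trans se; rewrite ler_piMl ?(ltW s0)// ler_norml; lra.
Unshelve. all: by end_near. Qed.

(** Once the square of the scale times [ln n / 2] is 1, the distance to 1 is that square times a
    bounded quantity. *)
Lemma cvg_clt_var :
  (\sum_(k < n) p k * (1 - p k)) * clt_scale n ^+ 2 @[n --> \oo] --> (1 : R).
Proof.
apply/cvgrPdist_le => e e0; near=> n.
have [n0 s0 s2] : [/\ (0 < n)%N, 0 < clt_scale n &
    clt_scale n ^+ 2 * (ln n%:R / 2) = 1] by near: n; exact: near_clt_scale.
have se : `|clt_scale n| <= e.
  by near: n; move/cvgr0Pnorm_le : cvg_clt_scale; apply.
have s1 : `|clt_scale n| <= 1.
  by near: n; move/cvgr0Pnorm_le : cvg_clt_scale; apply.
rewrite ger0_norm ?(ltW s0)// in se s1.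
have h1 : ln n%:R <= H_ R n.
  by apply: le_trans (H_ge_ln n); rewrite ler_ln ?posrE ?ltr0n// ler_nat.
have h2 := H_le_ln n0; have h3 := H2_ge0 n; have h4 := H2_le2 n.
rewrite sum_staircase_var -[X in `|X - _|]s2 mulrC -mulrBl normrM.
rewrite [`|_ ^+ 2|]ger0_norm ?sqr_ge0//.
apply: le_trans (_ : clt_scale n ^+ 2 <= _).
  by rewrite ler_piMl ?sqr_ge0// ler_norml; lra.
by apply: le_trans se; rewrite expr2 ler_piMl// ltW.
Unshelve. all: by end_near. Qed.

Lemma continuous_Phi : continuous (@Phi R).
Proof.
by move=> x; apply/differentiable_continuous/derivable1_diffP;
  have [] := is_derive_Phi x.
Qed.

Lemma cvg_heat (u v : nat -> R) (s y : R) : 0 < s ->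
  u n @[n --> \oo] --> s -> v n @[n --> \oo] --> y ->
  heat (u n) (v n) @[n --> \oo] --> heat s y.
Proof.
move=> s0 us vy; rewrite /heat; apply: continuous_cvg; first exact: continuous_Phi.
apply: cvgM => //; apply: cvgV; first by rewrite gt_eqF// sqrtr_gt0.
by apply: continuous_cvg => //; exact: sqrt_continuous.
Qed.

Definition clt_stat (n i : nat) : R :=
  (i%:R - n%:R + ln n%:R / 2) / Num.sqrt (ln n%:R / 2).

(** With [V] the variance of the sum, the Lindeberg error is [heat_cst d] times the scale times
    [V * clt_scale n ^+ 2]; the last factor tends to 1, so the error vanishes with the scale. *)
Lemma cvg_smooth_clt (d y : R) : 0 < d ->
  bern_mean p n (fun i => heat d (y - clt_stat n i)) @[n --> \oo]
  --> heat (d + 1) y.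
Proof.
move=> d0.
(* [clt_stat] is not centred at the exact mean; the gap [m n] is moved into the space variable. *)
pose m n := (\sum_(k < n) p k - n%:R + ln n%:R / 2) * clt_scale n.
pose V n := \sum_(k < n) p k * (1 - p k).
have lim1 : heat (d + V n * clt_scale n ^+ 2) (y - m n) @[n --> \oo] --> heat (d + 1) y.
  apply: cvg_heat; first by rewrite addr_gt0.
    by apply: cvgD; [exact: cvg_cst|exact: cvg_clt_var].
  by rewrite -[X in _ --> X]subr0; apply: cvgB; [exact: cvg_cst|exact: cvg_clt_drift].
apply/cvgrPdist_le => e e0.
have C0 := heat_cst_ge0 d.
(* Chosen so that [heat_cst d * e' * 2 <= e / 2], where 2 bounds [V n * clt_scale n ^+ 2]; the added
   1 keeps the denominator positive. *)
pose e' := e / (4 * (1 + heat_cst d)).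
have e'0 : 0 < e' by rewrite divr_gt0// mulr_gt0// ltr_pwDl.
near=> n.
have [n0 s0 s2] : [/\ (0 < n)%N, 0 < clt_scale n &
    clt_scale n ^+ 2 * (ln n%:R / 2) = 1] by near: n; exact: near_clt_scale.
have s1 : `|clt_scale n| <= 1.
  by near: n; move/cvgr0Pnorm_le : cvg_clt_scale; apply.
have se : `|clt_scale n| <= e'.
  by near: n; move/cvgr0Pnorm_le : cvg_clt_scale; apply.
rewrite ger0_norm ?(ltW s0)// in se s1.
have V2 : `|1 - V n * clt_scale n ^+ 2| <= 1.
  by near: n; move/cvgrPdist_le : cvg_clt_var; apply.
have hl : `|heat (d + 1) y - heat (d + V n * clt_scale n ^+ 2) (y - m n)| <= e / 2.
  by near: n; move/cvgrPdist_le : lim1; apply; rewrite divr_gt0.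
have s01 : 0 <= clt_scale n <= 1 by rewrite (ltW s0).
have := bern_mean_heat n (y - m n) (@staircase_prob01 R) d0 (lexx d) s01.
rewrite -/(V n).
rewrite (@eq_bern_mean _ p n _ (fun i => heat d (y - clt_stat n i)));
  last first.
  move=> i; congr (heat d _); rewrite /clt_stat -/(clt_scale n) /m.
  by move: (\sum_(k < n) p k) (clt_scale n) => M c; ring.
have : heat_cst d * clt_scale n ^+ 3 * V n <= e / 2.
  have -> : heat_cst d * clt_scale n ^+ 3 * V n =
    heat_cst d * clt_scale n * (V n * clt_scale n ^+ 2) by ring.
  apply: le_trans (_ : heat_cst d * e' * 2 <= _).
    apply: ler_pM; rewrite ?mulr_ge0 ?(ltW s0)//.
    - by rewrite sumr_ge0// => k _; have /andP[? ?] := staircase_prob01 R k;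
        rewrite mulr_ge0// subr_ge0.
    - by rewrite ler_wpM2l.
    - by move: V2; rewrite ler_norml; lra.
  rewrite /e' mulrA [X in X <= _](_ : _ = e / 2 * (heat_cst d / (1 + heat_cst d))).
    rewrite ler_piMr ?divr_ge0 ?(ltW e0)// ler_pdivrMr ?ltr_pwDl//; lra.
  by field; rewrite gt_eqF// ltr_pwDl.
move: hl; rewrite !ler_norml.
move: (heat_cst d * _ * _) (heat (d + 1) y) (heat (d + _) _) (bern_mean _ _ _).
move=> a b c f; lra.
Unshelve. all: by end_near. Qed.

(** The indicator of a half-line is squeezed between heat profiles of standard deviation [t / A]
    shifted by [t] either way. The error splits in three: [A] controls the normal tails, [t] the
    shift and the extra variance, [n] the smoothed limit. *)
Lemma cvg_staircase_clt (x : R) :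
  bern_mean p n (fun i => (clt_stat n i <= x)%R%:R) @[n --> \oo] --> Phi x.
Proof.
apply/cvgrPdist_le => e e0.
have e3 : 0 < e / 3 by rewrite divr_gt0.
have [A A0 [A1 A2]] : exists2 A : R, 0 < A & 1 - Phi A <= e / 3 /\ Phi (- A) <= e / 3.
  near (+oo : set_system R) => A.
  exists A; first by near: A; exact: nbhs_pinfty_gt.
  split.
    have : `|1 - Phi A| <= e / 3.
      by near: A; move/cvgrPdist_le : (@cvg_Phi_pinfty R); exact.
    by apply: le_trans; exact: ler_norm.
  have : `|Phi (- A)| <= e / 3.
    near: A; have := @cvg_Phi_ninfty R => /cvgNy_compNP /cvgr0Pnorm_le; exact.
  by apply: le_trans; exact: ler_norm.
have lim (c : R) : heat ((t / A) ^+ 2 + 1) (x + c * t) @[t --> 0^'+] --> Phi x.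
  have -> : Phi x = Phi ((x + c * 0) / Num.sqrt ((0 / A) ^+ 2 + 1)).
    by rewrite mulr0 mul0r expr0n /= add0r sqrtr1 divr1 addr0.
  rewrite /heat; apply: continuous_cvg; first exact: continuous_Phi.
  apply: cvg_at_right_filter.
  apply: cvgM.
    apply: cvgD; first exact: cvg_cst.
    by apply: cvgM; [exact: cvg_cst|exact: cvg_id].
  apply: cvgV; first by rewrite mul0r expr0n /= add0r sqrtr1 oner_eq0.
  apply: continuous_cvg; first exact: sqrt_continuous.
  apply: cvgD; last exact: cvg_cst.
  apply: (@cvg_comp _ _ _ (fun t => t / A) (fun t => t ^+ 2)); last exact: exprn_continuous.
  by apply: cvgM; [exact: cvg_id|exact: cvg_cst].
have [t t0 [h1 h2]] : exists2 t : R, 0 < t &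
    `|Phi x - heat ((t / A) ^+ 2 + 1) (x + 1 * t)| <= e / 3 /\
    `|Phi x - heat ((t / A) ^+ 2 + 1) (x + -1 * t)| <= e / 3.
  near (0 : R)^'+ => t.
  exists t => //; split; near: t; [move/cvgrPdist_le : (lim 1)|
    move/cvgrPdist_le : (lim (-1))]; exact.
rewrite mul1r mulN1r in h1 h2.
have tA0 : 0 < t / A by rewrite divr_gt0.
have d0 : 0 < (t / A) ^+ 2 by rewrite exprn_gt0.
have htA y : heat ((t / A) ^+ 2) y = Phi (y / (t / A)).
  by rewrite /heat sqrtr_sqr gtr0_norm.
near=> n.
have k1 : `|heat ((t / A) ^+ 2 + 1) (x + t) -
    bern_mean p n (fun i => heat ((t / A) ^+ 2) (x + t - clt_stat n i))| <= e / 3.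
  by near: n; move/cvgrPdist_le : (@cvg_smooth_clt _ (x + t) d0); exact.
have k2 : `|heat ((t / A) ^+ 2 + 1) (x - t) -
    bern_mean p n (fun i => heat ((t / A) ^+ 2) (x - t - clt_stat n i))| <= e / 3.
  by near: n; move/cvgrPdist_le : (@cvg_smooth_clt _ (x - t) d0); exact.
(* Where the indicator is 1, the argument of [Phi] is at least [A]. *)
have up : bern_mean p n (fun i => (clt_stat n i <= x)%R%:R) <=
    bern_mean p n (fun i => heat ((t / A) ^+ 2) (x + t - clt_stat n i)) + (1 - Phi A).
  rewrite -[X in _ <= _ + X](bern_mean_cst p n) -bern_meanD.
  apply: ler_bern_mean => [|i]; first exact: staircase_prob01.
  rewrite htA; have [ix|ix] := leP (clt_stat n i) x.
    rewrite /= -lerBlDr opprB addrCA subrr addr0.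
    apply: Phi_nondecreasing; rewrite ler_pdivlMr// mulrCA divff ?gt_eqF// mulr1.
    lra.
  by rewrite addr_ge0 ?Phi_ge0// subr_ge0 Phi_le1.
(* Where the indicator is 0, the argument of [Phi] is at most [- A]. *)
have lo : bern_mean p n (fun i => heat ((t / A) ^+ 2) (x - t - clt_stat n i)) <=
    bern_mean p n (fun i => (clt_stat n i <= x)%R%:R) + Phi (- A).
  rewrite -[X in _ <= _ + X](bern_mean_cst p n) -bern_meanD.
  apply: ler_bern_mean => [|i]; first exact: staircase_prob01.
  rewrite htA; have [ix|ix] := leP (clt_stat n i) x.
    by apply: le_trans (Phi_le1 _) _; rewrite lerDl Phi_ge0.
  rewrite add0r; apply: Phi_nondecreasing.
  rewrite ler_pdivrMr// mulNr mulrCA divff ?gt_eqF// mulr1; lra.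
move: h1 h2 k1 k2 up lo; rewrite !ler_norml.
move: (bern_mean _ _ _) (bern_mean _ _ _) (bern_mean _ _ _) (heat _ _) (heat _ _).
move=> a b c f g; lra.
Unshelve. all: by end_near. Qed.


End staircase_clt.

(** * Laws of the tableau statistics *)

Section uniform_tableau.
Variables (R : realType) (n : nat).

Lemma unif_preimage (f : staircase n -> R) (A : set R) :
  unif R n (f @^-1` A) =
  ((\sum_S (f S \in A)%R%:R) / #|{: staircase n}|%:R)%:E.
Proof.
rewrite /unif; congr (_ / _)%:E.
rewrite -sum1_card natr_sum big_mkcond /=; apply: eq_bigr => S _.
rewrite inE; have -> : (S \in f @^-1` A) = (f S \in A).
  by apply/idP/idP => /set_mem h; exact: mem_set.
by case: (f S \in A).
Qed.

Lemma integral_unif (f : staircase n -> R) : (forall S, 0 <= f S) ->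
  (\int[unif R n]_S (f S)%:E)%E = ((\sum_S f S) / #|{: staircase n}|%:R)%:E.
Proof.
move=> f0.
have mA (A : set (staircase n)) : measurable A by [].
transitivity (\int[unif R n]_S
    (\sum_(T <- index_enum {: staircase n}) (f T)%:E * (\1_[set T] S)%:E))%E.
  apply: eq_integral => S _.
  rewrite (bigD1 S) //= indicE mem_set// mule1 big1 ?adde0// => T TS.
  by rewrite indicE memNset ?mule0//= => /esym/eqP; apply/negP.
rewrite ge0_integral_sum//; last first.
  by move=> T S _; rewrite -EFinM lee_fin mulr_ge0.
rewrite mulr_suml -sumEFin; apply: eq_bigr => T _.
rewrite ge0_integralZl ?lee_fin//.
rewrite integral_indic// setIT EFinM; congr (_ * _)%E.
(* Written as a preimage, the singleton has its mass computed by [unif_preimage]. *)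
have -> : [set T] = (fun S : staircase n => (S == T)%:R : R) @^-1` [set 1].
  apply/seteqP; split => S /=; first by move=> ->; rewrite eqxx.
  by case: eqP => //= _ /eqP; rewrite eq_sym oner_eq0.
apply: etrans (unif_preimage _ _) _; rewrite (bigD1 T) //= eqxx mem_set// big1 ?addr0 ?div1r//.
by move=> S /negbTE ->; rewrite memNset//= => /eqP; rewrite eq_sym oner_eq0.
Qed.

Lemma expectation_unif (f : staircase n -> R) : (forall S, 0 <= f S) ->
  ('E_(unif R n)[f])%E = ((\sum_S f S) / #|{: staircase n}|%:R)%:E.
Proof. by move=> f0; rewrite unlock integral_unif. Qed.

(** * Law, moments and distribution function, for both statistics at once *)

Section statistic.
Variables (X : {RV (unif R n) >-> R}) (c : staircase n -> nat).
Hypothesis XE : forall S, X S = (c S)%:R.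
Hypothesis mean_c : forall h : nat -> R,
  (\sum_S h (c S)) / #|{: staircase n}|%:R = bern_mean (@staircase_prob R) n h.

Lemma statistic_law (A : set R) : distribution (unif R n) X A =
  (bern_mean (@staircase_prob R) n (fun i => ((i%:R : R) \in A)%R%:R))%:E.
Proof.
rewrite -mean_c; apply: etrans (unif_preimage _ _) _.
by congr (_ / _)%:E; apply: eq_bigr => S _; rewrite XE.
Qed.

Lemma statistic_mean : ('E_(unif R n)[X])%E = (n%:R - H_ R n / 2)%:E.
Proof.
rewrite expectation_unif => [|S]; last by rewrite XE.
rewrite -sum_staircase_prob -bern_mean_id -mean_c.
by congr (_ / _)%:E; apply: eq_bigr => S _; exact: XE.
Qed.

Lemma statistic_var : ('V_(unif R n)[X])%E = (H_ R n / 2 - H2_ R n / 4)%:E.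
Proof.
rewrite /variance [in LHS]unlock statistic_mean /=.
rewrite expectation_unif => [|S]; last by rewrite /= -expr2 sqr_ge0.
have h := bern_mean_var (@staircase_prob R) n (\sum_(k < n) staircase_prob R k).
rewrite -sum_staircase_prob -sum_staircase_var.
rewrite subrr expr0n /= addr0 in h; rewrite -h -mean_c.
by congr (_ / _)%:E; apply: eq_bigr => S _; rewrite expr2 -XE.
Qed.

Lemma statistic_cdf x : cdf (rescaled X) x =
  (bern_mean (@staircase_prob R) n (fun i => (clt_stat R n i <= x)%R%:R))%:E.
Proof.
rewrite -mean_c; apply: etrans (unif_preimage _ _) _.
congr (_ / _)%:E; apply: eq_bigr => S _; congr (nat_of_bool _)%:R.
rewrite /rescaled /tableau_rv /= /tableau_fun XE /clt_stat.
by apply/idP/idP; rewrite inE /= in_itv.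
Qed.

End statistic.

Lemma Delta_nE S : Delta_n R n S = (num_bd (val S))%:R.
Proof. by []. Qed.

Lemma Gamma_nE S : Gamma_n R n S = #|[set b | is_ag (val S b)]%SET|%:R.
Proof. by []. Qed.

End uniform_tableau.

(** * The law of a sum of independent indicators *)

Section indicator_sums.
Variables (R : realType) (n : nat) (d : measure_display).
Variables (T : measurableType d) (P : probability T R).
Variable I : 'I_n -> {RV P >-> R}.
Hypothesis HI : staircase_indicators I.

Let atom (b : {ffun 'I_n -> bool}) : set T :=
  \bigcap_(j in [set` [set: 'I_n]%SET]) (I j @^-1` [set (b j)%:R]).

Let measurable_atom b : measurable (atom b).
Proof.
apply: fin_bigcap_measurable; first exact: finite_finset.
by move=> j _; rewrite -[X in measurable X]setTI; exact: measurable_funP.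
Qed.

Let P_atom b : P (atom b) =
  (\prod_(k < n) if b k then staircase_prob R k else 1 - staircase_prob R k)%:E.
Proof.
have [ind P1 P0] := HI.
rewrite /atom ind// -prodEFin; apply: eq_big => k; first by rewrite inE.
by move=> _; case: (b k); rewrite ?P1// P0 /staircase_prob subKr.
Qed.

Let rv_sum_atom b w : atom b w -> rv_sum I w = (\sum_(k < n) b k)%N%:R.
Proof.
move=> bw; rewrite /rv_sum /= /sum_fun natr_sum; apply: eq_bigr => k _.
by apply: (bw k); rewrite /= finset.in_setT.
Qed.

Let atom_disjoint (D : set {ffun 'I_n -> bool}) : trivIset D atom.
Proof.
move=> b c _ _ [w [bw cw]]; apply/ffunP => k.
have kT : [set` [set: 'I_n]%SET] k by rewrite /= finset.in_setT.
have := bw k kT; rewrite /= (cw k kT : I k w = _).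
by case: (b k) (c k) => [] [] // /eqP; rewrite ?oner_eq0 // eq_sym oner_eq0.
Qed.

(** The indicators may leave 0 and 1 on a null set, so the atoms need not cover [T]; the inclusion
    of a union of atoms gives one inequality. *)
Let law_ge (A : set R) : measurable A ->
  ((bern_mean (@staircase_prob R) n (fun i => ((i%:R : R) \in A)%R%:R))%:E <=
   distribution P (rv_sum I) A)%E.
Proof.
move=> mA.
pose r := [seq b : {ffun 'I_n -> bool} <- enum {: {ffun 'I_n -> bool}} | ((\sum_(k < n) b k)%N%:R : R) \in A].
have -> : (bern_mean (@staircase_prob R) n (fun i => ((i%:R : R) \in A)%R%:R))%:E
    = P (\bigcup_(b in [set` r]) atom b).
  rewrite measure_fin_bigcup//.
  rewrite -fsbig_seq; last by rewrite filter_uniq// enum_uniq.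
  rewrite big_filter big_enum_cond /= bern_mean_expand -sumEFin big_mkcond /=.
  rewrite [RHS]big_mkcond /=; apply: eq_bigr => b _.
  by rewrite P_atom; case: ifP => _; rewrite ?mulr1// mulr0.
rewrite -[leRHS]/(P (rv_sum I @^-1` A)); apply: le_measure; rewrite ?inE.
- by apply: fin_bigcup_measurable => //; exact: finite_finset.
- by rewrite -[X in measurable X]setTI; exact: measurable_funP.
- move=> w [b /=]; rewrite mem_filter => /andP[bA _] /rv_sum_atom wb.
  by rewrite /preimage /= wb; rewrite inE in bA.
Qed.

(** The lower bounds of [law_ge] for [A] and for its complement add up to 1, which forces equality
    in both. *)
Lemma rv_sum_law (A : set R) : measurable A -> distribution P (rv_sum I) A =
  (bern_mean (@staircase_prob R) n (fun i => ((i%:R : R) \in A)%R%:R))%:E.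
Proof.
move=> mA; have h1 := law_ge mA; have h2 := law_ge (measurableC mA).
have hC : distribution P (rv_sum I) (~` A) = (1 - distribution P (rv_sum I) A)%E.
  exact: probability_setC.
move: h2; rewrite hC.
set D := distribution _ _ _ in h1 *.
have -> : bern_mean (@staircase_prob R) n (fun i => ((i%:R : R) \in ~` A)%R%:R) =
    1 - bern_mean (@staircase_prob R) n (fun i => ((i%:R : R) \in A)%R%:R).
  apply/eqP; rewrite eq_sym subr_eq -bern_meanD; apply/eqP.
  rewrite -[LHS](bern_mean_cst (@staircase_prob R) n); apply: eq_bern_mean => i.
  by rewrite in_setC; case: (_ \in A); rewrite /= ?addr0 ?add0r.
have Df : D \is a fin_num by exact: fin_num_measure.
rewrite -(fineK Df) in h1 *.
rewrite -EFinB lee_fin in h1 *; rewrite lee_fin => h2.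
by congr EFin; apply/eqP; rewrite eq_le; apply/andP; split; lra.
Qed.

End indicator_sums.

(** * Existence of the independent indicators *)

Section indicator_existence.
Variables (R : realType) (n : nat).

Let cube := {ffun 'I_n -> bool}.
(** Integers past the enumeration get the default point, but [cube_prob] gives them no mass. *)
Let point_of (m : nat) : cube := nth [ffun=> false] (enum {: cube}) m.
Let weight (k : nat) (c : bool) : R :=
  if c then staircase_prob R k else 1 - staircase_prob R k.

Let weight_ge0 k c : 0 <= weight k c.
Proof.
have /andP[h1 h2] := staircase_prob01 R k.
by rewrite /weight; case: c; [exact: h1|rewrite subr_ge0].
Qed.

Let weight_sum k : \sum_(c : bool) weight k c = 1.
Proof. by rewrite big_bool /weight /= addrC subrK. Qed.

Let cube_weight (b : cube) : R := \prod_(k < n) weight k (b k).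

Let cube_weight_ge0 b : 0 <= cube_weight b.
Proof. by apply: prodr_ge0 => k _; exact: weight_ge0. Qed.

(* The atom [m : nat] encodes the [m]-th element of the cube. *)
Let cube_prob := msum (fun m => mscale (NngNum (cube_weight_ge0 (point_of m)))
   (@dirac _ nat m R)) #|{: cube}|.

Let cube_probE (A : set nat) (B : pred cube) :
  (forall m, A m <-> B (point_of m)) ->
  cube_prob A = (\sum_(b : cube | B b) cube_weight b)%:E.
Proof.
move=> AB; rewrite /cube_prob /msum -sumEFin [RHS]big_mkcond /=.
rewrite -[RHS]big_enum /= (big_nth [ffun=> false]) big_mkord -cardE.
apply: eq_bigr => m _; rewrite /mscale /= diracE.
case: ifP => [Bm|/negP Bm].
  by rewrite mem_set ?mule1//; exact/AB.
by rewrite memNset ?mule0// => /AB.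
Qed.

Let cube_prob_setT : cube_prob setT = 1%E.
Proof.
rewrite (@cube_probE setT predT)//; congr EFin.
rewrite /cube_weight -(bigA_distr_bigA (fun k c => weight (nat_of_ord k) c)) /=.
by apply: big1 => k _; exact: weight_sum.
Qed.

HB.instance Definition _ := Measure.on cube_prob.
HB.instance Definition _ := Measure_isProbability.Build _ _ _ cube_prob
  cube_prob_setT.

Let coord (k : 'I_n) (m : nat) : R := (point_of m k)%:R.

Let measurable_coord k : measurable_fun setT (coord k).
Proof. by []. Qed.

HB.instance Definition _ k := @isMeasurableFun.Build _ _ _ _ (coord k)
  (measurable_coord k).

(** Exchanging sum and product factorises the weight; a coordinate outside [J] is unconstrained and
    contributes 1. Singletons [J] give the marginals, general [J] independence. *)
Let cube_prob_coord (J : {set 'I_n}) (A : 'I_n -> set R) :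
  cube_prob (\bigcap_(j in [set` J]) (coord j @^-1` A j)) =
  (\prod_(j in J) \sum_(c : bool | ((c%:R : R) \in A j)%R) weight j c)%:E.
Proof.
rewrite (@cube_probE _ (fun b : cube =>
    [forall j in J, ((b j)%:R : R) \in A j])); last first.
  move=> m; split=> [h|/forall_inP h j /= jJ].
    by apply/forall_inP => j jJ; rewrite inE; exact: (h j).
  by have := h j jJ; rewrite inE.
congr EFin; rewrite big_mkcond [RHS]big_mkcond /=.
pose F (j : 'I_n) (c : bool) : R :=
  if (j \in J) ==> ((c%:R : R) \in A j) then weight j c else 0.
transitivity (\sum_(b : cube) \prod_(j < n) F j (b j)).
  apply: eq_bigr => b _; case: ifP => [/forall_inP h|/negP h].
    apply: eq_bigr => j _; rewrite /F; case: ifP => // /negP[].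
    by apply/implyP; exact: h.
  apply/esym/eqP/prodf_eq0.
  have /forallPn[j] : ~~ [forall j in J, ((b j)%:R : R) \in A j] by apply/negP.
  by move=> hj; exists j => //; rewrite /F (negbTE hj).
rewrite -(bigA_distr_bigA F); apply: eq_bigr => j _; rewrite /F.
case: ifP => jJ /=; first by rewrite -big_mkcond.
exact: weight_sum.
Qed.

Lemma staircase_indicators_exist :
  exists (d : measure_display) (T : measurableType d) (P : probability T R)
    (I : 'I_n -> {RV P >-> R}), staircase_indicators I.
Proof.
pose P : probability nat R := cube_prob.
pose I (k : 'I_n) : {RV P >-> R} := coord k.
have PI k (A : set R) : P (I k @^-1` A) =
    (\sum_(c : bool | ((c%:R : R) \in A)%R) weight k c)%:E.
  have := cube_prob_coord [set k]%SET (fun=> A); rewrite big_set1 => <-.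
  congr (cube_prob _); apply/seteqP; split => [m Am j /=|m /(_ k)].
    by rewrite finset.in_set1 => /eqP ->.
  by apply; rewrite /= finset.in_set1.
exists _, nat, P, I; split.
- move=> J A _; rewrite [LHS]cube_prob_coord -prodEFin.
  by apply: eq_bigr => j _; rewrite PI.
- move=> k; rewrite PI; congr EFin; rewrite big_mkcond big_bool /=.
  rewrite mem_set// memNset ?addr0//= => /eqP; by rewrite eq_sym oner_eq0.
- move=> k; rewrite PI; congr EFin; rewrite big_mkcond big_bool /=.
  rewrite memNset ?mem_set ?add0r//=; last by move=> /eqP; rewrite oner_eq0.
  by rewrite /weight /staircase_prob subKr.
Qed.

End indicator_existence.

Lemma statistic_clt (R : realType) (X : forall n, {RV (unif R n) >-> R})
    (c : forall n, staircase n -> nat) :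
  (forall n S, X n S = (c n S)%:R) ->
  (forall n (h : nat -> R), (\sum_S h (c n S)) / #|{: staircase n}|%:R =
     bern_mean (@staircase_prob R) n h) ->
  cvg_in_distribution (fun n => rescaled (X n)) (normal_prob 0 1).
Proof.
move=> XE mean_c x _.
have -> : (fun n => cdf (rescaled (X n)) x) = (fun n => (bern_mean
    (@staircase_prob R) n (fun i => (clt_stat R n i <= x)%R%:R))%:E).
  by apply/funext => n; rewrite (statistic_cdf (XE n) (mean_c n)).
suff h : (bern_mean (@staircase_prob R) n
    (fun i => (clt_stat R n i <= x)%R%:R))%:E @[n --> \oo] --> (Phi x)%:E.
  by rewrite PhiE in h.
by apply: cvg_EFin; [exact: nearW|exact: cvg_staircase_clt].
Qed.

Theorem theorem8 (R : realType) :
  (forall n : nat, (1 <= n)%N ->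
     exists (d : measure_display) (T : measurableType d) (P : probability T R)
       (I : 'I_n -> {RV P >-> R}), staircase_indicators I)
  /\
  [/\ forall n : nat, (1 <= n)%N ->
        [/\ forall (d : measure_display) (T : measurableType d)
                (P : probability T R) (I : 'I_n -> {RV P >-> R}),
              staircase_indicators I -> same_law (Delta_n R n) (rv_sum I),
            ('E_(unif R n)[Delta_n R n])%E = (n%:R - H_ R n / 2)%:E
          & ('V_(unif R n)[Delta_n R n])%E = (H_ R n / 2 - H2_ R n / 4)%:E]
    & cvg_in_distribution (fun n => rescaled (Delta_n R n)) (normal_prob 0 1)]
  /\
  [/\ forall n : nat, (1 <= n)%N ->
        same_law (Gamma_n R n) (Delta_n R n),
      forall n : nat, (1 <= n)%N ->
        [/\ forall (d : measure_display) (T : measurableType d)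
                (P : probability T R) (I : 'I_n -> {RV P >-> R}),
              staircase_indicators I -> same_law (Gamma_n R n) (rv_sum I),
            ('E_(unif R n)[Gamma_n R n])%E = (n%:R - H_ R n / 2)%:E
          & ('V_(unif R n)[Gamma_n R n])%E = (H_ R n / 2 - H2_ R n / 4)%:E]
    & cvg_in_distribution (fun n => rescaled (Gamma_n R n)) (normal_prob 0 1)].
Proof.
have DE n := @Delta_nE R n; have GE n := @Gamma_nE R n.
have Dm n := @mean_tableau_bd R n; have Gm n := @mean_tableau_ag R n.
split=> [n _|]; first exact: staircase_indicators_exist.
split; split.
- move=> n _; split.
  + by move=> d T P I HI A mA; rewrite (statistic_law (DE n) (Dm n)) rv_sum_law.
  + exact: statistic_mean (DE n) (Dm n).
  + exact: statistic_var (DE n) (Dm n).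
- exact: statistic_clt DE Dm.
- move=> n _ A mA.
  by rewrite (statistic_law (GE n) (Gm n)) (statistic_law (DE n) (Dm n)).
- move=> n _; split.
  + by move=> d T P I HI A mA; rewrite (statistic_law (GE n) (Gm n)) rv_sum_law.
  + exact: statistic_mean (GE n) (Gm n).
  + exact: statistic_var (GE n) (Gm n).
- exact: statistic_clt GE Gm.
Qed.
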